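(* Let $n\geq2$. For any $K\in\mathcal K_+^\infty$ in $\mathbb{R}^n$, one has $$V(K,D[n-1])^2\geq V(K,K,D[n-2])\cdot\mathrm{vol}_n(D).$$
   Context: $\mathcal K_+^\infty$ is the class of convex bodies (non-empty compact convex sets) in $\mathbb{R}^n$ with non-empty interior, smooth boundary and positive Gauss–Kronecker curvature. $D\subset\mathbb{R}^n$ is the origin-centered unit Euclidean ball. The mixed volume of convex bodies $K_1,\dots,K_n$ is $$V(K_1,\dots,K_n)=\frac1{n!}\frac{\partial^n}{\partial\lambda_1\cdots\partial\lambda_n}\bigg|_{\lambda_1=\dots=\lambda_n=0}\mathrm{vol}_n(\lambda_1K_1+\cdots+\lambda_nK_n),$$ where the function being differentiated is, for $\lambda_i\geq0$, a homogeneous polynomial of degree $n$. $D[j]$ means that $D$ is repeated $j$ times. *)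

(* Defs.v *)
From HB Require Import structures.
From mathcomp Require Import all_boot all_order all_algebra.
From mathcomp Require Import all_classical all_reals all_analysis.
Set Implicit Arguments.
Unset Strict Implicit.
Unset Printing Implicit Defensive.
Import Order.TTheory GRing.Theory Num.Theory.
Import numFieldNormedType.Exports.
Local Open Scope classical_set_scope.
Local Open Scope ring_scope.

(* The library has no Lebesgue measure on ['rV[R]_n].  It is obtained here as the
   n-fold product of the library's one-dimensional Lebesgue measure on
   R * (R * ( ... * unit)), read on row vectors through [row_of]. *)

Record measureSpace (R : realType) := MeasureSpace {
  ms_disp : measure_display;
  ms_car : measurableType ms_disp;
  ms_mu : {sigma_finite_measure set ms_car -> \bar R} }.

Section product.
Context (R : realType) (S T : measureSpace R).

Definition product_mu : set (ms_car S * ms_car T) -> \bar R :=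
  (ms_mu S \x ms_mu T)%E.

HB.instance Definition _ := Measure.on product_mu.

(* The library's sigma-finite instance for [\x] is shadowed by the one for
   subprobabilities and is not inferable, hence this proof. *)
Let product_mu_sigma_finite : sigma_finite setT product_mu.
Proof.
have /sigma_finiteP[F [TF ndF Foo]] := sigma_finiteT (ms_mu S).
have /sigma_finiteP[G [TG ndG Goo]] := sigma_finiteT (ms_mu T).
exists (fun n => F n `*` G n).
  rewrite -setXTT TF TG predeqE => -[x y]; split.
    move=> [/= [n _ Fnx] [k _ Gky]]; exists (maxn n k) => //; split.
    - by move: x Fnx; exact/subsetPset/ndF/leq_maxl.
    - by move: y Gky; exact/subsetPset/ndG/leq_maxr.
  by move=> [n _ []/= ? ?]; split; exists n.
move=> k; have [? ?] := Foo k; have [? ?] := Goo k.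
split; first exact: measurableX.
by rewrite [ltLHS]product_measure1E// lte_mul_pinfty// ge0_fin_numE.
Qed.

HB.instance Definition _ := Measure_isSigmaFinite.Build _ _ _ product_mu
  product_mu_sigma_finite.

Definition product_space : measureSpace R :=
  @MeasureSpace R _ (ms_car S * ms_car T)%type product_mu.

End product.

Fixpoint lebesgue_space (R : realType) (n : nat) : measureSpace R :=
  if n is m.+1 then
    product_space (MeasureSpace (@lebesgue_measure R)) (lebesgue_space R m)
  else @MeasureSpace R _ unit (\d_ tt).

Fixpoint row_of (R : realType) (n : nat) :
    ms_car (lebesgue_space R n) -> 'rV[R]_n :=
  match n with
  | 0 => fun=> 0
  | m.+1 => fun p => row_mx (p.1)%:M (row_of p.2) : 'rV[R]_(1 + m)
  end.

Definition vol (R : realType) (n : nat) (A : set 'rV[R]_n) : \bar R :=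
  ms_mu (lebesgue_space R n) (@row_of R n @^-1` A).

Definition minkowski_comb (R : realType) (n m : nat) (K : 'I_m -> set 'rV[R]_n)
    (lambda : 'rV[R]_m) : set 'rV[R]_n :=
  [set \sum_(i < m) lambda 0 i *: x i | x in [set x | forall i, K i (x i)]].

(* The volume of a Minkowski combination is polynomial in its coefficients only
   where these are nonnegative, hence the one-sided derivative. *)
Definition right_partial (R : realType) (m : nat) (i : 'I_m)
    (f : 'rV[R]_m -> R) (lambda : 'rV[R]_m) : R :=
  lim (h^-1 * (f (lambda + h *: delta_mx 0 i) - f lambda) @[h --> 0^'+]).

Definition mixed_volume (R : realType) (n : nat) (K : 'I_n -> set 'rV[R]_n) : R :=
  (n`!%:R)^-1 *
  foldr (@right_partial R n) (fun lambda => fine (vol (minkowski_comb K lambda)))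
    (enum 'I_n) 0.

(* The library's norm on ['rV[R]_n] is the sup norm; it is used only for its
   topology and for differentiation. *)

Definition norm2 (R : realType) (n : nat) (x : 'rV[R]_n) : R :=
  Num.sqrt (\sum_(i < n) x 0 i ^+ 2).

Definition unit_ball (R : realType) (n : nat) : set 'rV[R]_n :=
  [set x | norm2 x <= 1].
Arguments unit_ball : clear implicits.

Definition convex_body (R : realType) (n : nat) (K : set 'rV[R]_n) : Prop :=
  [/\ K !=set0, compact K & convex_set (K : set (convex_lmodType 'rV[R]_n))].

Definition boundary (T : topologicalType) (A : set T) : set T :=
  closure A `\` A°.

Definition partial (R : realType) (n : nat) (i : 'I_n) (f : 'rV[R]_n -> R) :
    'rV[R]_n -> R :=
  'D_(delta_mx 0 i) f.

(* C^oo on U: all iterated partial derivatives exist and are differentiable. *)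
Definition smooth_on (R : realType) (n : nat) (U : set 'rV[R]_n)
    (f : 'rV[R]_n -> R) : Prop :=
  forall (s : seq 'I_n) (x : 'rV[R]_n), U x ->
    differentiable (foldr (@partial R n) f s) x.

Definition gradient (R : realType) (n : nat) (f : 'rV[R]_n -> R) (x : 'rV[R]_n) :
    'rV[R]_n :=
  \row_i partial i f x.

(* Near x, K is a regular sublevel set of f; thus inside U the boundary of K is
   the smooth hypersurface f = 0, with outward normal along the gradient. *)
Definition defining_function (R : realType) (n : nat) (K : set 'rV[R]_n)
    (x : 'rV[R]_n) (U : set 'rV[R]_n) (f : 'rV[R]_n -> R) : Prop :=
  [/\ open U, U x, smooth_on U f,
      forall y, U y -> gradient f y != 0 &
      forall y, U y -> (K y <-> f y <= 0)].

Definition smooth_boundary (R : realType) (n : nat) (K : set 'rV[R]_n) : Prop :=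
  forall x, boundary K x -> exists U f, defining_function K x U f.

Definition gauss_map (R : realType) (n : nat) (f : 'rV[R]_n -> R)
    (x : 'rV[R]_n) : 'rV[R]_n :=
  (norm2 (gradient f x))^-1 *: gradient f x.

(* The rows of E form an orthonormal basis of the hyperplane orthogonal to u. *)
Definition orthonormal_frame (R : realType) (n : nat) (u : 'rV[R]_n)
    (E : 'M[R]_(n.-1, n)) : Prop :=
  E *m E^T = 1%:M /\ u *m E^T = 0.

(* The determinant of the Weingarten map (the differential of the outward Gauss
   map on the tangent hyperplane), written in an orthonormal tangent frame E.
   It depends neither on f nor on E, so [get] selects the only candidate. *)
Definition gauss_kronecker_curvature (R : realType) (n : nat)
    (K : set 'rV[R]_n) (x : 'rV[R]_n) : R :=
  get [set k : R | exists U f (E : 'M[R]_(n.-1, n)),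
    [/\ defining_function K x U f,
        orthonormal_frame (gauss_map f x) E &
        k = \det (E *m 'J (gauss_map f) x *m E^T)]].

Definition K_plus_infty (R : realType) (n : nat) (K : set 'rV[R]_n) : Prop :=
  [/\ convex_body K, K° !=set0, smooth_boundary K &
      forall x, boundary K x -> 0 < gauss_kronecker_curvature K x].

(* Main.v *)
Require Import Defs.
From HB Require Import structures.
From mathcomp Require Import all_boot all_order all_algebra.
From mathcomp Require Import all_classical all_reals all_analysis.
From mathcomp Require Import measurable_realfun qpoly ring lra.
Set Implicit Arguments.
Unset Strict Implicit.
Unset Printing Implicit Defensive.
Import Order.TTheory GRing.Theory Num.Theory.
Import numFieldNormedType.Exports.
Local Open Scope classical_set_scope.
Local Open Scope ring_scope.

(** The inequality is the second-order consequence at s = 0 of the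
Brunn-Minkowski inequality for the family s K + t D.

If g(s, t) = vol(s K + t D) is a polynomial, g(s, t) = sum_k c_k s^k t^(n-k)
on the quadrant s, t >= 0, then iterating the one-sided derivatives gives
c_k = 'C(n, k) V(K[k], D[n-k]) ([mixed_volume_coef]).  Write V = vol(D) = c_0
and choose a so that the function phi(s) = g(s, 1 - a s) has no linear term,
namely a = V(K, D[n-1]) / V.  The midpoint form of Brunn-Minkowski,
vol(A) vol(B) <= vol((A + B) / 2)^2 ([brunn_minkowski_midpoint]), applied to
D and 2s K + (1 - 2as) D, gives phi(0) phi(2s) <= phi(s)^2 for small s > 0,
which forces the coefficient of s^2 in phi to be nonpositive
([log_concave_second_order]).  That coefficient is
'C(n, 2) (V(K, K, D[n-2]) - V(K, D[n-1])^2 / V), whence the claim.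

The polynomiality of g ([steiner]) rests on the fact that the ball is a limit
of zonotopes, which avoids approximating K.  For a segment S = [0, v] the volume
of L + t S is affine in t >= 0 ([volR_segment]): along lines parallel to v, each
nonempty section is lengthened by t |v|.  By induction on the number of summands,
vol(K + t Z) is a polynomial in t >= 0 for every zonotope Z
([volR_sum_zonotope]), and its degree is at most n because it grows at most
like t^n.  A pointwise limit of polynomials of degree at most n is such a
polynomial by Lagrange interpolation ([poly_approx]), so it remains to enclose
a zonotope between (1 - e) D and (1 + e) D ([ball_zonotope]).  By rotation
invariance the integral of |<u, x>| over u in D is a constant multiple of |x|;
cutting D into small pieces turns the integral into a finite sum
sum_i |<v_i, x>|, the support function of a zonotope, uniformly close to that
multiple of |x|.

Brunn-Minkowski is proved by induction on the dimension: the volumes of the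
slices of A, B and their midpoint set satisfy the hypothesis of a
one-dimensional Prekopa-Leindler inequality ([prekopa_leindler]).  All facts
about the volume come from its definition as an iterated product: Fubini in
both orders gives invariance under translations and shears, hence the
determinant formula for linear maps ([vol_linear]). *)

(** * Borel sets of row vectors *)

Section borel_sets.
Context (R : realType).

(** Row vectors carry no sigma-algebra; a set of them is measured through its
preimage in the iterated product. *)
Definition borel n (A : set 'rV[R]_n) : Prop := measurable (@row_of R n @^-1` A).

Fixpoint row_inv n : 'rV[R]_n -> ms_car (lebesgue_space R n) :=
  match n with
  | 0 => fun=> tt
  | m.+1 => fun x : 'rV[R]_(1 + m) => (lsubmx x 0 0, row_inv (rsubmx x))
  end.

Lemma row_invK n : cancel (@row_inv n) (@row_of R n).
Proof.
elim: n => [x|n IH x] /=; first by rewrite thinmx0 /=; apply/rowP => -[].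
by rewrite /= IH -mx11_scalar hsubmxK.
Qed.

Lemma row_ofK n : cancel (@row_of R n) (@row_inv n).
Proof.
elim: n => [[]//|n IH [a p]] /=.
by rewrite row_mxKl row_mxKr IH mxE eqxx mulr1n.
Qed.

Lemma measurable_coord n (i : 'I_n) :
  measurable_fun setT (fun p => @row_of R n p 0 i).
Proof.
elim: n i => [[]//|n IH i] /=.
case: (@split_ordP 1 n i) => j ->.
  rewrite [X in measurable_fun _ X](_ : _ = fst); first exact: measurable_fst.
  by apply/funext => p; rewrite [LHS]row_mxEl ord1 mxE eqxx mulr1n.
rewrite [X in measurable_fun _ X](_ : _ = (fun p => row_of p 0 j) \o snd).
  exact: (measurableT_comp (IH j) measurable_snd).
by apply/funext => p; rewrite [LHS]row_mxEr.
Qed.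

Lemma measurable_row_inv d (T : measurableType d) n (f : T -> 'rV[R]_n) :
  (forall i, measurable_fun setT (fun t => f t 0 i)) ->
  measurable_fun setT (fun t => row_inv (f t)).
Proof.
elim: n f => [f _|n IH f mf] /=; first exact: measurable_cst.
apply: measurable_fun_pair.
  under eq_fun do rewrite mxE; exact: mf.
apply: IH => i.
under eq_fun do rewrite mxE; exact: mf.
Qed.

Lemma borel_preimage m n (f : 'rV[R]_m -> 'rV[R]_n) (A : set 'rV[R]_n) :
  (forall i, measurable_fun setT (fun p => f (@row_of R m p) 0 i)) ->
  borel A -> borel (f @^-1` A).
Proof.
move=> mf mA; rewrite /borel.
have := measurable_row_inv mf measurableT mA; rewrite setTI.
by congr measurable; apply/seteqP; split=> p /=; rewrite row_invK.
Qed.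

(** An open set is the union of the countably many balls it contains whose center
and radius are rational. *)
Lemma borel_open n (A : set 'rV[R]_n) : open A -> borel A.
Proof.
move=> oA.
pose I := ('rV[rat]_n * nat)%type.
pose ctr (q : I) : 'rV[R]_n := map_mx ratr q.1.
pose rad (q : I) : R := q.2.+1%:R^-1.
pose D := [set q : I | ball (ctr q) (rad q) `<=` A].
have -> : A = \bigcup_(q in D) ball (ctr q) (rad q).
  apply/seteqP; split=> [x Ax|x [q Dq] /Dq //].
  have /nbhs_ballP[e e0 xeA] : nbhs x A by exact: open_nbhs_nbhs.
  have [k ke] : exists k : nat, (k.+1%:R^-1 : R) < e / 2.
    have e20 : 0 < e / 2 by rewrite divr_gt0.
    by have [k _ /(_ k (leqnn k))] := near_infty_natSinv_lt (PosNum e20); exists k.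
  have k0 : 0 < k.+1%:R^-1 :> R by rewrite invr_gt0.
  have [q qx] : exists q : 'rV[rat]_n, forall i, `|ratr (q 0 i) - x 0 i| < k.+1%:R^-1.
    have H i : exists r : rat, `|ratr r - x 0 i| < k.+1%:R^-1.
      have [r] := @rat_in_itvoo R (x 0 i - k.+1%:R^-1) (x 0 i + k.+1%:R^-1)
        ltac:(by rewrite ltrD2l gtrN).
      by rewrite in_itv /= => xr; exists r; rewrite ltr_distl.
    have [f Hf] := choice H.
    by exists (\row_i f i) => i; rewrite mxE.
  exists (q, k) => /=.
    move=> y [_ /= qy]; apply: xeA; split => // i j.
    have := qy i j; rewrite /ball/= /ball_/= /ctr/= mxE ord1 => qy1.
    have := qx j; rewrite distrC => qx1.
    rewrite /rad/= in qy1.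
    rewrite (le_lt_trans (ler_distD (ratr (q 0 j)) _ _))// (lt_le_trans (ltrD qx1 qy1))//.
    by rewrite [leRHS]splitr lerD// ltW.
  split => // i j; rewrite /ctr /= /ball/= /ball_/= mxE ord1; exact: qx.
rewrite /borel preimage_bigcup.
rewrite bigcup_mkcond; apply: countable_bigcupT_measurable => [|q].
  exact: countableP.
case: ifPn => // _.
have -> : @row_of R n @^-1` ball (ctr q) (rad q) =
    \bigcap_(i in [set: 'I_n]) ((fun p => @row_of R n p 0 i) @^-1`
      ball (ctr q 0 i) (rad q)).
  apply/seteqP; split.
    by move=> p [_ /= H] i _; exact: H.
  move=> p /= H; split; first by rewrite /rad invr_gt0.
  by move=> i j; rewrite ord1; exact: H.
apply: fin_bigcap_measurable => // i _; rewrite -[X in measurable X]setTI.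
by apply: measurable_coord => //; exact: measurable_ball.
Qed.

Lemma borelC n (A : set 'rV[R]_n) : borel A -> borel (~` A).
Proof. by move=> mA; rewrite /borel preimage_setC; exact: measurableC. Qed.

Lemma borel_closed n (A : set 'rV[R]_n) : closed A -> borel A.
Proof. by move=> /closed_openC/borel_open/borelC; rewrite setCK. Qed.

Lemma borel_compact n (A : set 'rV[R]_n) : compact A -> borel A.
Proof. move=> /compact_closed cA; apply/borel_closed/cA; exact: norm_hausdorff. Qed.

End borel_sets.

(** * Affine changes of variable on the line *)
Section lebesgue_affine_maps.
Context (R : realType).
Notation leb := (@lebesgue_measure R).

Lemma lebesgue_measure_affine (c b : R) (A : set (measurableTypeR R)) :
  c != 0 -> measurable A ->
  leb ((fun x => c * x + b) @^-1` A) = (`|c|^-1%:E * leb A)%E.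
Proof.
move=> c0 mA.
pose f : measurableTypeR R -> measurableTypeR R := fun x => c * x + b.
have mf : measurable_fun setT f.
  by apply: measurable_funD => //; exact: mulrl_measurable.
have c0' : 0 <= `|c| by [].
(* |c| times the image of Lebesgue measure agrees with it on intervals *)
pose mu := mscale (NngNum c0')
  (measure_function_pushforward__canonical__measure_function_Measure leb mf).
have -> : leb A = mu A.
  apply: lebesgue_measure_unique => // _ [[p q] _ <-] /=.
  rewrite /mu /mscale /= /pushforward.
  rewrite /= !lebesgue_measure_itv /= lte_fin.
  have [c_gt0|c_lt0|] := ltgtP 0 c; last by move/eqP; rewrite eq_sym (negbTE c0).
    have -> : f @^-1` `]p, q]%classic = `]((p - b) / c), ((q - b) / c)]%classic.
      apply/seteqP; split=> x /=; rewrite !in_itv /= ltr_pdivrMr// ler_pdivlMr// ltrBlDr lerBrDr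
        ![x * c]mulrC//.
    rewrite lebesgue_measure_itv /= lte_fin ltr_pM2r ?invr_gt0// ltrD2r.
    case: ifP => _; last by rewrite mule0.
    rewrite -!EFinB -EFinM; congr EFin; rewrite gtr0_norm//; field; lra.
  have -> : f @^-1` `]p, q]%classic = `[((q - b) / c), ((p - b) / c)[%classic.
    apply/seteqP; split=> x /=; rewrite !in_itv /= ltr_ndivlMr// ler_ndivrMr// ltrBlDr lerBrDr
        ![x * c]mulrC//; by rewrite andbC.
  rewrite lebesgue_measure_itv /= lte_fin ltr_nM2r ?invr_lt0// ltrD2r.
  case: ifP => _; last by rewrite mule0.
  rewrite -!EFinB -EFinM; congr EFin; rewrite ltr0_norm//; field; lra.
by rewrite /mu /mscale /= /pushforward muleA -EFinM mulVf ?normr_eq0// mul1e.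
Qed.

Lemma ge0_integral_affine (c b : R) (f : measurableTypeR R -> \bar R) : c != 0 ->
  measurable_fun setT f -> (forall x, 0 <= f x)%E ->
  (\int[leb]_x f (c * x + b)%R = `|c|^-1%:E * \int[leb]_x f x)%E.
Proof.
move=> c0 mf f0.
pose g : measurableTypeR R -> measurableTypeR R := fun x => c * x + b.
have mg : measurable_fun setT g.
  by apply: measurable_funD => //; exact: mulrl_measurable.
have := @ge0_integral_pushforward _ _ _ _ R g mg leb setT f measurableT mf
  (fun y _ => f0 y).
rewrite preimage_setT => <-.
have c0' : 0 <= `|c|^-1 by [].
rewrite -(@ge0_integral_mscale _ _ R leb setT measurableT (NngNum c0') f)//.
apply: eq_measure_integral => A mA _ /=.
by rewrite /pushforward /mscale /= -(lebesgue_measure_affine b c0 mA).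
Qed.
End lebesgue_affine_maps.

(** * Slices and translations *)
Section slices.
Context (R : realType).
Notation leb := (@lebesgue_measure R).

Lemma measurable_coord_shift n (v : 'rV[R]_n) i :
  measurable_fun setT (fun p => (@row_of R n p + v) 0 i).
Proof.
under eq_fun do rewrite mxE.
apply: measurable_funD => //; exact: measurable_coord.
Qed.

Definition slice n (A : set 'rV[R]_n.+1) (a : R) : set 'rV[R]_n :=
  [set y | A (row_mx a%:M y : 'rV_(1 + n))].

Definition fiber n (A : set 'rV[R]_n.+1) (y : 'rV[R]_n) : set (measurableTypeR R) :=
  [set a | A (row_mx a%:M y : 'rV_(1 + n))].

Lemma xsection_slice n (A : set 'rV[R]_n.+1) a :
  xsection (@row_of R n.+1 @^-1` A) a = @row_of R n @^-1` slice A a.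
Proof. by apply/seteqP; split=> x; rewrite /xsection /= inE. Qed.

Lemma ysection_fiber n (A : set 'rV[R]_n.+1) p :
  ysection (@row_of R n.+1 @^-1` A) p = fiber A (row_of p).
Proof. by apply/seteqP; split=> x; rewrite /ysection /= inE. Qed.

Lemma vol_slice n (A : set 'rV[R]_n.+1) :
  vol A = (\int[leb]_a vol (slice A a))%E.
Proof. by apply: eq_integral => a _ /=; rewrite xsection_slice. Qed.

Lemma borel_slice n (A : set 'rV[R]_n.+1) a : borel A -> borel (slice A a).
Proof. by move=> mA; rewrite /borel -xsection_slice; exact: measurable_xsection. Qed.

Lemma measurable_fiber n (A : set 'rV[R]_n.+1) y : borel A -> measurable (fiber A y).
Proof.
by move=> mA; rewrite -(row_invK y) -ysection_fiber; exact: measurable_ysection.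
Qed.

Lemma measurable_vol_slice n (A : set 'rV[R]_n.+1) : borel A ->
  measurable_fun setT (fun a : measurableTypeR R => vol (slice A a)).
Proof.
move=> mA; have := measurable_fun_xsection (ms_mu (lebesgue_space R n)) mA.
by apply: eq_measurable_fun => a _ /=; rewrite xsection_slice.
Qed.

Lemma measurable_leb_fiber n (A : set 'rV[R]_n.+1) : borel A ->
  measurable_fun setT (fun p => leb (fiber A (@row_of R n p))).
Proof.
move=> mA; have := measurable_fun_ysection leb mA.
by apply: eq_measurable_fun => a _ /=; rewrite ysection_fiber.
Qed.

(** Fubini with the first coordinate integrated first; [vol_slice] is the other
order, which is the definition of the product measure. *)
Lemma vol_fiber n (A : set 'rV[R]_n.+1) : borel A ->
  vol A = (\int[ms_mu (lebesgue_space R n)]_p leb (fiber A (row_of p)))%E.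
Proof.
move=> mA.
have := indic_fubini_tonelli leb (ms_mu (lebesgue_space R n)) mA.
rewrite indic_fubini_tonelli_FE // indic_fubini_tonelli_GE //.
by under [RHS]eq_integral do rewrite /= ysection_fiber.
Qed.

Lemma le_vol n (A B : set 'rV[R]_n) : borel A -> borel B -> A `<=` B ->
  (vol A <= vol B)%E.
Proof. by move=> mA mB AB; apply: le_measure; rewrite ?inE// => p; exact: AB. Qed.

Lemma row_mx_scalarD n (a b : R) (x y : 'rV[R]_n) :
  row_mx a%:M x + row_mx b%:M y = row_mx (a + b)%:M (x + y) :> 'rV_(1 + n).
Proof. by rewrite add_row_mx -raddfD. Qed.

Lemma row_mx_scalar_comb n (s t a b : R) (x y : 'rV[R]_n) :
  s *: row_mx a%:M x + t *: row_mx b%:M y =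
  row_mx (s * a + t * b)%:M (s *: x + t *: y) :> 'rV_(1 + n).
Proof.
by rewrite (scale_row_mx s) (scale_row_mx t) add_row_mx !scale_scalar_mx -raddfD.
Qed.

Lemma row_mx_scalar_ind n (P : 'rV[R]_n.+1 -> Prop) :
  (forall a y, P (row_mx a%:M y : 'rV_(1 + n))) -> forall v, P v.
Proof.
by move=> H v; rewrite -[v](@hsubmxK R 1 1 n) [lsubmx _]mx11_scalar; exact: H.
Qed.

Lemma borel_shift n (v : 'rV[R]_n) A : borel A -> borel ((+%R^~ v) @^-1` A).
Proof. by apply: borel_preimage; exact: measurable_coord_shift. Qed.

Lemma vol_shift n (v : 'rV[R]_n) A : borel A -> vol ((+%R^~ v) @^-1` A) = vol A.
Proof.
elim: n v A => [|n IH] v A mA.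
  by congr vol; apply/seteqP; split=> x /=; rewrite [v]thinmx0 addr0.
elim/row_mx_scalar_ind: v => b w.
rewrite [LHS]vol_slice [RHS]vol_slice.
transitivity (\int[leb]_a vol (slice A (1 * a + b)%R))%E.
  apply: eq_integral => a _; rewrite -(IH w (slice A _)); last exact: borel_slice.
  by rewrite mul1r; congr vol; apply/seteqP; split=> y; rewrite /slice /= -row_mx_scalarD.
rewrite (@ge0_integral_affine R 1 b (fun a => vol (slice A a)))//.
  by rewrite normr1 invr1 mul1e.
exact: measurable_vol_slice.
Qed.

End slices.

(** * Linear changes of variable *)
Section linear_maps.
Context (R : realType).
Notation leb := (@lebesgue_measure R).

Lemma borel_mulmx m n (M : 'M[R]_(m, n)) A : borel A -> borel ((mulmxr M) @^-1` A).
Proof.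
apply: borel_preimage => i.
under eq_fun do rewrite mxE.
apply: measurable_sum => j; apply: measurable_funM => //.
exact: measurable_coord.
Qed.

(** Stated with preimages, so that the property is multiplicative and sections of
the preimage are preimages of sections. *)
Definition scales_vol n (M : 'M[R]_n) := forall A, borel A ->
  (`|\det M|%:E * vol ((mulmxr M) @^-1` A) = vol A)%E.

Lemma scales_volM n (M N : 'M[R]_n) :
  scales_vol M -> scales_vol N -> scales_vol (M *m N).
Proof.
move=> HM HN A mA.
have -> : mulmxr (M *m N) @^-1` A = mulmxr M @^-1` (mulmxr N @^-1` A).
  by apply/seteqP; split=> x /=; rewrite mulmxA.
rewrite det_mulmx normrM mulrC EFinM -muleA HM ?HN//.
exact: borel_mulmx.
Qed.

(** This shear translates every slice. *)
Lemma scales_vol_upper n (w : 'rV[R]_n) :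
  scales_vol (block_mx 1%:M w 0 1%:M : 'M[R]_(1 + n)).
Proof.
move=> A mA; rewrite det_ublock !det1 mulr1 normr1 mul1e.
rewrite [LHS]vol_slice [RHS]vol_slice; apply: eq_integral => a _.
rewrite -(vol_shift (a *: w) (borel_slice a mA)).
congr vol; apply/seteqP; split=> y; rewrite /slice /=;
  by rewrite mul_row_block !mulmx0 !mulmx1 addr0 mul_scalar_mx addrC.
Qed.

(** This shear translates every line parallel to the first axis. *)
Lemma scales_vol_lower n (v : 'cV[R]_n) :
  scales_vol (block_mx 1%:M 0 v 1%:M : 'M[R]_(1 + n)).
Proof.
move=> A mA; rewrite det_lblock !det1 mulr1 normr1 mul1e.
rewrite vol_fiber; last exact: borel_mulmx.
rewrite [RHS]vol_fiber //; apply: eq_integral => p _.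
rewrite -[RHS]mul1e.
have -> : (1 = `|1 : R|^-1%:E)%E by rewrite normr1 invr1.
rewrite -(lebesgue_measure_affine ((row_of p *m v) 0 0)) ?oner_neq0//; last first.
  exact: measurable_fiber.
congr (lebesgue_measure _); apply/seteqP; split=> a; rewrite /fiber /=;
  by rewrite mul_row_block !mulmx0 !mulmx1 add0r raddfD mul1r /= -mx11_scalar.
Qed.

Lemma scales_vol_diag n (a : R) (N : 'M[R]_n) : a != 0 -> scales_vol N ->
  scales_vol (block_mx a%:M 0 0 N : 'M[R]_(1 + n)).
Proof.
move=> a0 HN A mA; rewrite det_lblock det_scalar1 normrM.
rewrite [in LHS]vol_slice [RHS]vol_slice mulrC EFinM muleAC -ge0_integralZl//=.
- transitivity (`|a|%:E * \int[leb]_x vol (slice A (a * x + 0)%R))%E.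
    rewrite muleC; congr (_ * _)%E; apply: eq_integral => x _.
    rewrite -(HN (slice A _)); last exact: borel_slice.
    congr (_ * vol _)%E; apply/seteqP; split=> y; rewrite /slice /=;
      by rewrite mul_row_block !mulmx0 add0r addr0 addr0 -scalar_mxM mulrC.
  rewrite (@ge0_integral_affine R a 0 (fun a => vol (slice A a)))//.
    by rewrite muleA -EFinM mulfV ?normr_eq0// mul1e.
  exact: measurable_vol_slice.
- by apply: measurable_vol_slice; exact: borel_mulmx.
Qed.

(** Block elimination writes M as shear * block diagonal * shear, where the lower
right block of the diagonal factor is the Schur complement S of the corner. *)
Lemma scales_vol_schur n (M : 'M[R]_(1 + n)) :
  (forall N : 'M[R]_n, N \in unitmx -> scales_vol N) ->
  M \in unitmx -> M 0 0 != 0 -> scales_vol M.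
Proof.
move=> IH uM a0.
pose a := M 0 0; pose v := dlsubmx M; pose w := ursubmx M.
pose S := drsubmx M - a^-1 *: (v *m w).
have defM : M = block_mx 1%:M 0 (a^-1 *: v) 1%:M *m block_mx a%:M 0 0 S *m
    block_mx 1%:M (a^-1 *: w) 0 1%:M.
  rewrite !mulmx_block !(mulmx0, mulmx1, mul0mx, mul1mx, addr0, add0r).
  rewrite -[LHS]submxK; congr block_mx.
  - by rewrite [LHS]mx11_scalar !mxE; congr (M _ _)%:M; apply/val_inj.
  - by rewrite mul_scalar_mx scalerA mulfV// scale1r.
  - by rewrite -scalemxAl mul_mx_scalar scalerA mulVf// scale1r.
  - rewrite -!scalemxAl -!scalemxAr mul_mx_scalar -scalemxAl 2!scalerA.
    by rewrite mulVf// mulr1 addrC subrK.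
have uS : S \in unitmx.
  move: uM; rewrite defM !unitmxE !det_mulmx det_lblock det_lblock det_ublock !det1.
  by rewrite det_scalar1 !mul1r !mulr1 unitrM => /andP[].
rewrite defM; apply: scales_volM; last exact: scales_vol_upper.
apply: scales_volM; first exact: scales_vol_lower.
apply: scales_vol_diag => //; exact: IH.
Qed.

(** When the corner of M vanishes, adding to the first column another column with
a nonzero entry in the first row is a shear that makes it nonzero. *)
Theorem vol_linear n (M : 'M[R]_n) : M \in unitmx -> scales_vol M.
Proof.
elim: n M => [|n IH] M uM.
  move=> A mA; rewrite det_mx00 normr1 mul1e; congr vol.
  by apply/seteqP; split=> x /=; rewrite [x *m M]thinmx0 [x]thinmx0.
rewrite -[n.+1]/(1 + n)%N in M uM *.
have [a0|a0] := eqVneq (M 0 0) 0; last exact: scales_vol_schur.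
have [j Mj] : exists j : 'I_n, M 0 (rshift 1 j) != 0.
  apply/existsP; apply: contraTT uM => /existsPn M0.
  have M0' k : M 0 k = 0.
    case: (split_ordP k) => j ->; last by apply/eqP; move: (M0 j); rewrite negbK.
    by rewrite -[RHS]a0 ord1; congr (M _ _); exact: val_inj.
  rewrite unitmxE (expand_det_row M 0) big1 ?unitr0// => k _.
  by rewrite M0' mul0r.
pose L (s : R) : 'M[R]_(1 + n) := block_mx 1%:M 0 (s *: delta_mx j 0) 1%:M.
have -> : M = (M *m L 1) *m L (-1).
  rewrite -mulmxA mulmx_block !(mulmx0, mulmx1, mul0mx, mul1mx, addr0, add0r).
  by rewrite -scalerDl subrr scale0r -scalar_mx_block mulmx1.
apply: scales_volM; last exact: scales_vol_lower.
apply: scales_vol_schur => //.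
  by rewrite unitmx_mul uM unitmxE det_lblock !det1 mulr1 unitr1.
suff -> : (M *m L 1) 0 0 = M 0 (rshift 1 j) by [].
have -> : 0 = lshift n 0 :> 'I_(1 + n) by exact: val_inj.
rewrite -[in LHS](submxK M) mulmx_block block_mxEul mxE !mulmx1.
rewrite scale1r -colE.
rewrite !mxE.
rewrite (_ : M (lshift n 0) (lshift n 0) = 0) ?add0r; last first.
  by rewrite -[RHS]a0; congr (M _ _); exact: val_inj.
by congr (M _ _); exact: val_inj.
Qed.

End linear_maps.

(** * Minkowski sums and dilates of convex bodies *)
Section convex_compact_sets.
Context (R : realType) (n : nat).
Implicit Types (A B C : set 'rV[R]_n).

Definition is_convex A := forall x y s t, A x -> A y -> 0 <= s -> 0 <= t ->
  s + t = 1 -> A (s *: x + t *: y).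

Definition msum A B : set 'rV[R]_n := [set x + y | x in A & y in B].
Definition dilate (c : R) A : set 'rV[R]_n := [set c *: x | x in A].

Definition body A := [/\ A !=set0, compact A & is_convex A].

Lemma convex_body_body A : convex_body A -> body A.
Proof.
case=> A0 cA vA; split => // x y s t Ax Ay s0 t0 st.
have s01 : 0 <= s <= 1 by rewrite s0 -st lerDl.
have := vA x y (Itv01 s0 (andP s01).2) (mem_set Ax) (mem_set Ay).
have -> : t = 1 - s by rewrite -st addrC addKr.
by move/set_mem.
Qed.

Lemma compact_msum A B : compact A -> compact B -> compact (msum A B).
Proof.
move=> cA cB.
have -> : msum A B = (fun p => p.1 + p.2) @` (A `*` B).
  apply/seteqP; split=> [_ [a Aa [b Bb <-]]|_ [[a b] [/= Aa Bb] <-]].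
    by exists (a, b).
  by exists a => //; exists b.
apply: (@continuous_compact _ _ (fun p : 'rV[R]_n * 'rV[R]_n => p.1 + p.2)).
  by apply: continuous_subspaceT; exact: add_continuous.
exact: compact_setX.
Qed.

Lemma compact_dilate c A : compact A -> compact (dilate c A).
Proof.
move=> cA; apply: continuous_compact => //.
apply: continuous_subspaceT => x; exact: scaler_continuous.
Qed.

Lemma convex_msum A B : is_convex A -> is_convex B -> is_convex (msum A B).
Proof.
move=> vA vB _ _ s t [a Aa [b Bb <-]] [a' Aa' [b' Bb' <-]] s0 t0 st.
exists (s *: a + t *: a'); first exact: vA.
by exists (s *: b + t *: b'); [exact: vB|rewrite !scalerDr addrACA].
Qed.

Lemma convex_dilate c A : is_convex A -> is_convex (dilate c A).
Proof.
move=> vA _ _ s t [a Aa <-] [b Ab <-] s0 t0 st.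
exists (s *: a + t *: b); first exact: vA.
by rewrite scalerDr !scalerA ![c * _]mulrC.
Qed.

Lemma body_msum A B : body A -> body B -> body (msum A B).
Proof.
move=> [[x Ax] cA vA] [[y By] cB vB]; split; [|exact: compact_msum|exact: convex_msum].
by exists (x + y), x => //; exists y.
Qed.

Lemma body_dilate c A : body A -> body (dilate c A).
Proof.
move=> [[x Ax] cA vA]; split; [|exact: compact_dilate|exact: convex_dilate].
by exists (c *: x), x.
Qed.

Lemma body_set1 x : body [set x].
Proof.
split; [by exists x|exact: compact_set1|].
by move=> _ _ s t -> -> _ _ st; rewrite -scalerDl st scale1r.
Qed.

Lemma msumC A B : msum A B = msum B A.
Proof.
by apply/seteqP; split=> _ [a Aa [b Bb <-]]; exists b => //; exists a => //;
  rewrite addrC.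
Qed.

Lemma msumA A B C : msum A (msum B C) = msum (msum A B) C.
Proof.
apply/seteqP; split.
  move=> _ [a Aa [_ [b Bb [c Cc <-]] <-]]; exists (a + b).
    by exists a => //; exists b.
  by exists c => //; rewrite addrA.
move=> _ [_ [a Aa [b Bb <-]] [c Cc <-]]; exists a => //; exists (b + c).
  by exists b => //; exists c.
by rewrite addrA.
Qed.

Lemma msumS A A' B B' : A `<=` A' -> B `<=` B' -> msum A B `<=` msum A' B'.
Proof.
by move=> AA BB _ [a /AA ? [b /BB ? <-]]; exists a => //; exists b.
Qed.

Lemma dilateS c A B : A `<=` B -> dilate c A `<=` dilate c B.
Proof. by move=> AB _ [a /AB ? <-]; exists a. Qed.

Lemma dilate_msum c A B : dilate c (msum A B) = msum (dilate c A) (dilate c B).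
Proof.
apply/seteqP; split.
  move=> _ [_ [a Aa [b Bb <-]] <-]; exists (c *: a); first by exists a.
  by exists (c *: b); [exists b|rewrite scalerDr].
move=> _ [_ [a Aa <-] [_ [b Bb <-] <-]]; exists (a + b).
  by exists a => //; exists b.
by rewrite scalerDr.
Qed.

Lemma dilateM c d A : dilate c (dilate d A) = dilate (c * d) A.
Proof.
apply/seteqP; split=> [_ [_ [a Aa <-] <-]|_ [a Aa <-]].
  by exists a; rewrite ?scalerA.
by exists (d *: a); rewrite ?scalerA//; exists a.
Qed.

Lemma dilate1 A : dilate 1 A = A.
Proof.
by apply/seteqP; split=> [_ [a Aa <-]|a Aa]; [|exists a]; rewrite ?scale1r.
Qed.

Lemma dilate0 A : A !=set0 -> dilate 0 A = [set 0].
Proof.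
move=> [a Aa]; apply/seteqP; split=> [_ [b Bb <-]|_ ->] /=; first by rewrite scale0r.
by exists a; rewrite ?scale0r.
Qed.

Lemma dilate_set0 c : dilate c [set 0] = [set 0].
Proof.
apply/seteqP; split=> [_ [_ -> <-]|_ ->] /=; first by rewrite scaler0.
by exists 0; rewrite ?scaler0.
Qed.

Lemma msum0 A : msum A [set 0] = A.
Proof.
apply/seteqP; split=> [_ [a Aa [_ -> <-]]|a Aa]; first by rewrite addr0.
by exists a => //; exists 0; rewrite ?addr0.
Qed.

(** By convexity, c a + d b is (c + d) times a point of A. *)
Lemma dilateD c d A : is_convex A -> 0 <= c -> 0 <= d ->
  dilate (c + d) A = msum (dilate c A) (dilate d A).
Proof.
move=> vA c0 d0; apply/seteqP; split.
  move=> _ [a Aa <-]; exists (c *: a); first by exists a.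
  by exists (d *: a); [exists a|rewrite scalerDl].
move=> _ [_ [a Aa <-] [_ [b Ab <-] <-]].
have [cd0|cd0] := eqVneq (c + d) 0.
  move/eqP: (cd0); rewrite paddr_eq0// => /andP[/eqP-> /eqP->].
  by exists a; rewrite ?addr0 ?scale0r ?addr0.
have cdp : 0 < c + d by rewrite lt_neqAle eq_sym cd0 addr_ge0.
exists ((c / (c + d)) *: a + (d / (c + d)) *: b).
  apply: vA => //; rewrite ?divr_ge0// ?addr_ge0//.
  by rewrite -mulrDl mulfV.
by rewrite scalerDr !scalerA ![(c + d) * _]mulrC !divfK.
Qed.

Lemma dilate_le c d A : is_convex A -> A 0 -> 0 <= c -> c <= d ->
  dilate c A `<=` dilate d A.
Proof.
move=> vA A0 c0 cd; rewrite -[d](subrKC c) dilateD ?subr_ge0// => _ [a Aa <-].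
exists (c *: a); first by exists a.
by exists 0; rewrite ?addr0//; exists 0; rewrite ?scaler0.
Qed.

End convex_compact_sets.

(** * Volumes of compact sets *)
Section volume_of_compacts.
Context (R : realType).

Definition volR n (A : set 'rV[R]_n) : R := fine (vol A).

Lemma coord_le_norm n (x : 'rV[R]_n) i : `|x 0 i| <= `|x|.
Proof.
by rewrite [leRHS]/Num.norm /= mx_normrE; apply/bigmax_geP; right; exists (0, i).
Qed.

Lemma norm_le_coord n (x : 'rV[R]_n) r : 0 <= r -> (forall i, `|x 0 i| <= r) -> `|x| <= r.
Proof.
move=> r0 H; rewrite [leLHS]/Num.norm /= mx_normrE; apply/bigmax_leP; split=> //.
by move=> [i j] _ /=; rewrite ord1.
Qed.

Lemma compact_box n (r : R) : compact [set x : 'rV[R]_n | forall i, `|x 0 i| <= r].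
Proof.
have -> : [set x : 'rV[R]_n | forall i, `|x 0 i| <= r] =
    [set x : 'rV[R]_n | forall i, `[- r, r]%classic (x 0 i)].
  by apply/seteqP; split=> x /= H i; have := H i; rewrite in_itv /= ler_norml.
by apply: (@rV_compact R n (fun=> `[- r, r]%classic)) => _; exact: segment_compact.
Qed.

Lemma vol_box_fin n (r : R) :
  (vol [set x : 'rV[R]_n | forall i, `|x 0 i| <= r]%R < +oo)%E.
Proof.
elim: n => [|n IH].
  by rewrite /vol /= diracE; case: (_ \in _); rewrite ltry.
rewrite /vol /=.
have -> : @row_of R n.+1 @^-1` [set x | forall i, `|x 0 i| <= r]%R =
    `[- r, r]%classic `*` (@row_of R n @^-1` [set x | forall i, `|x 0 i| <= r]%R).
  apply/seteqP; split=> [[a p] /= H|[a p] /= [ar H]] /=.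
    split=> [|i]; first by rewrite in_itv /= -ler_norml; have := H (@lshift 1 n 0);
      rewrite [X in `|X|]row_mxEl mxE eqxx.
    by have := H (rshift 1 i); rewrite [X in `|X|]row_mxEr.
  move=> i; case: (@split_ordP 1 n i) => j ->.
    by rewrite [X in `|X|]row_mxEl ord1 mxE eqxx mulr1n; move: ar; rewrite in_itv /= -ler_norml.
  by rewrite [X in `|X|]row_mxEr.
rewrite [ltLHS]product_measure1E//=; last first.
  exact: (borel_compact (@compact_box n r)).
apply: lte_mul_pinfty => //; rewrite lebesgue_measure_itv/=.
by case: ifP.
Qed.

Lemma vol_fin n (A : set 'rV[R]_n) : compact A -> vol A \is a fin_num.
Proof.
move=> cA; rewrite ge0_fin_numE//.
have [M [_ HM]] := compact_bounded cA.
apply: le_lt_trans (vol_box_fin n (M + 1)); apply: le_vol.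
- exact: borel_compact.
- exact/borel_compact/compact_box.
- have M1 : M < M + 1 by rewrite ltrDl.
  by move=> x /(HM _ M1) xM i; apply: le_trans xM; exact: coord_le_norm.
Qed.

Lemma volRE n (A : set 'rV[R]_n) : compact A -> vol A = (volR A)%:E.
Proof. by move=> cA; rewrite fineK// vol_fin. Qed.

Lemma volR_ge0 n (A : set 'rV[R]_n) : 0 <= volR A.
Proof. exact: fine_ge0. Qed.

Lemma le_volR n (A B : set 'rV[R]_n) : compact A -> compact B -> A `<=` B ->
  volR A <= volR B.
Proof.
move=> cA cB AB; rewrite -lee_fin -!volRE//.
by apply: le_vol => //; exact: borel_compact.
Qed.

Lemma volR_shift n (v : 'rV[R]_n) A : compact A -> volR (msum A [set v]) = volR A.
Proof.
move=> cA; rewrite /volR -(vol_shift (- v) (borel_compact cA)).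
congr (fine (vol _)); apply/seteqP; split=> [_ [a Aa [_ -> <-]]|x Ax] /=.
  by rewrite addrK.
by exists (x - v) => //; exists v; rewrite ?subrK.
Qed.

Lemma mulmxr_continuous m n (M : 'M[R]_(m, n)) :
  continuous (mulmxr M : 'rV[R]_m -> 'rV[R]_n).
Proof.
have -> : (mulmxr M : 'rV[R]_m -> 'rV[R]_n) = fun x => \sum_i x 0 i *: row i M.
  by apply/funext => x; rewrite -mulmx_sum_row.
move=> x; apply: continuous_big => [|i _ {}x]; first exact: add_continuous.
  by apply: cvgZr_tmp; [exact: (@nbhs_filter _ x)|exact: (@coord_continuous R 1 m 0 i x)].
Qed.

Lemma compact_linear m n (M : 'M[R]_(m, n)) (A : set 'rV[R]_m) :
  compact A -> compact (mulmxr M @` A).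
Proof.
move=> cA; apply: continuous_compact => //; apply: continuous_subspaceT.
exact: mulmxr_continuous.
Qed.

Lemma volR_linear n (M : 'M[R]_n) A : M \in unitmx -> compact A ->
  volR (mulmxr M @` A) = `|\det M| * volR A.
Proof.
move=> uM cA.
have cMA := compact_linear (M := M) cA.
have := vol_linear uM (borel_compact cMA).
have -> : mulmxr M @^-1` (mulmxr M @` A) = A.
  apply/seteqP; split=> [x [y Ay /= yx]|x Ax]; last by exists x.
  by rewrite -(mulmxK uM x) -yx mulmxK.
by rewrite !volRE// -EFinM => -[].
Qed.

Lemma volR_dilate n (c : R) (A : set 'rV[R]_n) : compact A -> 0 < c ->
  volR (dilate c A) = c ^+ n * volR A.
Proof.
move=> cA c0; have := @volR_linear n c%:M A _ cA.
rewrite unitmxE det_scalar unitfE expf_neq0 ?gt_eqF// => /(_ isT).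
rewrite gtr0_norm ?exprn_gt0// => <-; congr volR.
by apply/seteqP; split=> _ [a Aa <-]; exists a => //=; rewrite mul_mx_scalar.
Qed.

End volume_of_compacts.

(** * Adding a segment *)
Section sum_with_segment.
Context (R : realType).
Notation leb := (@lebesgue_measure R).

Definition segment n (t : R) (v : 'rV[R]_n) : set 'rV[R]_n :=
  [set s *: v | s in `[0, t]%classic].

Lemma body_segment n t (v : 'rV[R]_n) : 0 <= t -> body (segment t v).
Proof.
move=> t0; split.
- by exists (0 *: v), 0 => //=; rewrite in_itv /= lexx.
- apply: (@continuous_compact R _ (fun s : R => s *: v)); last exact: segment_compact.
  by apply: continuous_subspaceT => x; exact: scalel_continuous.
- move=> _ _ p q [a + <-] [b + <-] p0 q0 pq.
  rewrite /= !in_itv /= => /andP[a0 at_] /andP[b0 bt].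
  exists (p * a + q * b); last by rewrite scalerDl !scalerA.
  rewrite /= in_itv /= addr_ge0 ?mulr_ge0//=.
  by rewrite -[t]mul1r -pq mulrDl lerD// ler_wpM2l.
Qed.

Lemma compact_interval (I : set R) : I !=set0 -> compact I -> is_interval I ->
  exists2 ab : R * R, ab.1 <= ab.2 & I = `[ab.1, ab.2]%classic.
Proof.
move=> I0 cI iI.
have cid : {within I, continuous (id : R -> R)}.
  by apply: continuous_subspaceT => x; exact: cvg_id.
have [b /set_mem Ib Hb] := compact_EVT_max (f := id) I0 cI cid.
have [a /set_mem Ia Ha] := compact_EVT_min (f := id) I0 cI cid.
have ab : a <= b by exact/Ha/mem_set.
exists (a, b) => //=; apply/seteqP; split=> x /=.
  by move=> Ix; rewrite in_itv /= Ha ?Hb//; exact/mem_set.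
by rewrite in_itv /=; exact: iI.
Qed.

Definition e0 n : 'rV[R]_(1 + n) := row_mx 1%:M 0.

Lemma row_mx_e0 n a (y : 'rV[R]_n) :
  row_mx a%:M y = (row_mx 0 y : 'rV_(1 + n)) + a *: e0 n :> 'rV_(1 + n).
Proof.
by rewrite /e0 (scale_row_mx a) scale_scalar_mx mulr1 scaler0 add_row_mx add0r addr0.
Qed.

Lemma compact_fiber n (L : set 'rV[R]_n.+1) y : compact L -> compact (fiber L y : set R).
Proof.
move=> cL; have [M [_ HM]] := compact_bounded cL.
have M1 : M < M + 1 by rewrite ltrDl.
have cont : continuous (fun a : R => row_mx a%:M y : 'rV[R]_(1 + n)).
  have -> : (fun a : R => row_mx a%:M y : 'rV[R]_(1 + n)) =
      (fun a : R => (row_mx 0 y : 'rV_(1 + n)) + a *: e0 n).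
    by apply/funext => a; rewrite row_mx_e0.
  by move=> x; apply: cvgD; [exact: cvg_cst|exact: scalel_continuous].
apply: (subclosed_compact _ (@segment_compact R (- (M + 1)) (M + 1))).
- apply: (@preimage_closed R _ (fun a => (row_mx a%:M y : 'rV_(1 + n)))); last first.
    by apply: compact_closed cL; exact: norm_hausdorff.
  by move=> x _; exact: cont.
- move=> a /(HM _ M1) aM; rewrite /= in_itv /= -ler_norml.
  apply: le_trans (le_trans (coord_le_norm _ (@lshift 1 n 0)) aM).
  by rewrite [X in _ <= `|X|]row_mxEl mxE eqxx mulr1n.
Qed.

Lemma interval_fiber n (L : set 'rV[R]_n.+1) y : is_convex L -> is_interval (fiber L y : set R).
Proof.
move=> vL a b La Lb c /andP[ac cb].
have [E|ab] := eqVneq a b; first by have -> : c = a by lra.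
have ba : 0 < b - a by rewrite subr_gt0 lt_neqAle ab (le_trans ac).
rewrite /fiber /=.
have := vL _ _ ((b - c) / (b - a)) ((c - a) / (b - a)) La Lb.
rewrite !divr_ge0 ?subr_ge0 ?(le_trans ac)// => /(_ isT isT).
have pq : (b - c) / (b - a) + (c - a) / (b - a) = 1 by field; lra.
move=> /(_ pq); rewrite [X in L X]row_mx_scalar_comb -scalerDl pq scale1r.
by have -> : (b - c) / (b - a) * a + (c - a) / (b - a) * b = c by field; lra.
Qed.

Lemma fiber_msum_segment n (L : set 'rV[R]_n.+1) t y :
  fiber (msum L (segment t (e0 n))) y =
    [set a + s | a in fiber L y & s in `[0, t]%classic].
Proof.
apply/seteqP; split=> [a [] |_ [a /= La [s st <-]]].
  elim/row_mx_scalar_ind => b z Lz [_ [s st <-]].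
  rewrite /e0 (scale_row_mx s) scale_scalar_mx mulr1 scaler0 [LHS]row_mx_scalarD addr0.
  move=> E; have [/(congr1 (fun M : 'M[R]_1 => M 0 0))] := @eq_row_mx _ 1 1 n _ _ _ _ E.
  by rewrite !mxE eqxx !mulr1n => <- <-; exists b => //; exists s.
exists (row_mx a%:M y : 'rV_(1 + n)) => //; exists (s *: e0 n); first by exists s.
by rewrite !row_mx_e0 scalerDl addrA.
Qed.

(** An interval grows by exactly t, unless it is empty; moving the negative terms
to the other side gives an identity that can be integrated over all the lines,
empty sections included, in extended reals. *)
Lemma leb_sum_itv (I : set (measurableTypeR R)) (t : R) : 0 <= t ->
  compact (I : set R) -> is_interval (I : set R) ->
  (leb [set a + s | a in I & s in `[0, t]%classic]%R + t%:E * leb I =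
  leb I + t%:E * leb [set a + s | a in I & s in `[0, 1]%classic]%R)%E.
Proof.
move=> t0 cI iI.
have [->|I0] := eqVneq I set0.
  by rewrite !image2E !set0X !image_set0 measure0 !mule0.
have [[a b] /= ab ->] := compact_interval (iffLR (set0P _) I0) cI iI.
have E (r : R) : 0 <= r ->
    leb [set x + s | x in `[a, b]%classic & s in `[0, r]%classic] = (b + r - a)%:E.
  move=> r0.
  have -> : [set x + s | x in `[a, b]%classic & s in `[0, r]%classic] = `[a, b + r]%classic.
    apply/seteqP; split=> [_ [x + [s + <-]]|x] /=; rewrite !in_itv /=.
      rewrite [x \in _]in_itv [s \in _]in_itv /=.
      by move=> /andP[ax xb] /andP[s0 sr]; rewrite (le_trans ax) ?lerDl//= lerD.
    move=> /andP[ax xb]; have [xlb|bx] := leP x b.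
      by exists x; rewrite /= ?in_itv /= ?ax//; exists 0; rewrite ?addr0//= in_itv/= lexx.
    exists b; rewrite /= ?in_itv /= ?ab ?lexx//; exists (x - b); last by rewrite subrKC.
    by rewrite /= in_itv /= subr_ge0 (ltW bx) lerBlDl.
  rewrite lebesgue_measure_itv /= lte_fin EFinB.
  case: ltP => // h; rewrite -EFinB; congr EFin; lra.
rewrite !E// lebesgue_measure_itv /= lte_fin.
have -> : (if (a < b)%R then b%:E - a%:E else 0)%E = (b - a)%:E.
  case: ltP => h; rewrite ?EFinB//; rewrite -EFinB; congr EFin; lra.
rewrite -!EFinM -!EFinD; congr EFin; lra.
Qed.

Lemma volR_segment_e0 n (L : set 'rV[R]_n.+1) t : 0 <= t -> body L ->
  volR (msum L (segment t (e0 n))) =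
  volR L + t * (volR (msum L (segment 1 (e0 n))) - volR L).
Proof.
move=> t0 bL; have [_ cL vL] := bL.
have c1 s : 0 <= s -> compact (msum L (segment s (e0 n))).
  by move=> s0; apply: compact_msum => //; case: (body_segment (e0 n) s0).
have bo s : 0 <= s -> borel (msum L (segment s (e0 n))).
  by move=> s0; exact/borel_compact/c1.
have bb := borel_compact cL.
have : (vol (msum L (segment t (e0 n))) + t%:E * vol L =
  vol L + t%:E * vol (msum L (segment 1 (e0 n))))%E.
  rewrite !vol_fiber//; last 2 first.
    exact: bo. exact: bo.
  have mL : measurable_fun setT (fun p => leb (fiber L (@row_of R n p))).
    exact: measurable_leb_fiber.
  have mS r : 0 <= r -> measurable_fun setT
      (fun p => leb (fiber (msum L (segment r (e0 n))) (@row_of R n p))).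
    by move=> r0; apply: measurable_leb_fiber; exact: bo.
  rewrite -!ge0_integralZl// ?lee_fin//; last exact: mS.
  rewrite -!ge0_integralD//; try first [exact: mS
    | by apply: measurable_funeM
    | by apply: measurable_funeM; exact: mS
    | by move=> x _; rewrite mule_ge0 ?lee_fin].
  apply: eq_integral => p _; rewrite !fiber_msum_segment leb_sum_itv//.
  - exact: compact_fiber.
  - exact: interval_fiber.
rewrite !volRE//; [|exact: c1|exact: c1].
rewrite -!EFinM -!EFinD => -[]; lra.
Qed.

Lemma segment_linear n t (v : 'rV[R]_n) (M : 'M[R]_n) :
  segment t (v *m M) = mulmxr M @` segment t v.
Proof.
apply/seteqP; split=> [_ [s st <-]|_ [_ [s st <-] <-]] /=.
  by exists (s *: v); rewrite ?scalemxAl//; exists s.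
by exists s => //; rewrite scalemxAl.
Qed.

Lemma msum_linear n (M : 'M[R]_n) A B :
  mulmxr M @` msum A B = msum (mulmxr M @` A) (mulmxr M @` B).
Proof.
apply/seteqP; split.
  move=> _ [_ [a Aa [b Bb <-]] <-]; exists (a *m M); first by exists a.
  by exists (b *m M); [exists b|rewrite /= mulmxDl].
move=> _ [_ [a Aa <-] [_ [b Bb <-] <-]]; exists (a + b).
  by exists a => //; exists b.
by rewrite /= mulmxDl.
Qed.

Lemma body_linear n (M : 'M[R]_n) A : body A -> body (mulmxr M @` A).
Proof.
move=> [[a Aa] cA vA]; split; [by exists (a *m M), a|exact: compact_linear|].
move=> _ _ s t [x Ax <-] [y Ay <-] s0 t0 st; exists (s *: x + t *: y).
  exact: vA.
by rewrite /= mulmxDl !scalemxAl.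
Qed.

Lemma exists_unitmx_row n (v : 'rV[R]_n.+1) : v != 0 ->
  exists2 M, M \in unitmx & v = e0 n *m M.
Proof.
move=> v0.
have r1 : \rank v = 1%N.
  by apply/eqP; rewrite eqn_leq rank_leq_row lt0n mxrank_eq0.
exists (col_ebase v 0 0 *: row_ebase v).
  rewrite unitmxZ ?row_ebase_unit//.
  by have := col_ebase_unit v; rewrite unitmxE {1}[col_ebase v]mx11_scalar det_scalar1.
rewrite -{1}(mulmx_ebase v) r1 {1}[col_ebase v]mx11_scalar mul_scalar_mx.
rewrite -scalemxAl -scalemxAr; congr (_ *: (_ *m _)).
apply/rowP => j; rewrite !mxE; case: (@split_ordP 1 n j) => k -> /=.
  by rewrite [RHS]mxE ord1.
by rewrite mxE.
Qed.

(** A linear map sends the first basis vector to v, which reduces to the case of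
a segment along the first axis. *)
Theorem volR_segment n (L : set 'rV[R]_n) v t : 0 <= t -> body L ->
  volR (msum L (segment t v)) =
  volR L + t * (volR (msum L (segment 1 v)) - volR L).
Proof.
move=> t0 bL; have [v0|] := eqVneq v 0.
  have E s : 0 <= s -> segment s v = [set 0].
    move=> s0; rewrite v0; apply/seteqP; split=> [_ [r _ <-]|_ ->] /=.
      by rewrite scaler0.
    by exists 0; rewrite ?scaler0//= in_itv /= lexx.
  by rewrite !E// msum0 subrr mulr0 addr0.
case: n => [|n] in L v bL *; first by rewrite [v]thinmx0 eqxx.
move=> /exists_unitmx_row[M uM ->].
have EL : L = mulmxr M @` (mulmxr (invmx M) @` L).
  apply/seteqP; split=> [x Lx|_ [_ [x Lx <-] <-]] /=; last by rewrite mulmxKV.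
  by exists (x *m invmx M); [exists x|rewrite mulmxKV].
set L' := mulmxr (invmx M) @` L in EL.
have bL' : body L' by exact: body_linear.
clearbody L'.
rewrite EL !segment_linear -!msum_linear.
have cs s : 0 <= s -> compact (msum L' (segment s (e0 n))).
  by move=> s0; case: (body_msum bL' (body_segment (e0 n) s0)).
have [_ cL' _] := bL'.
rewrite (volR_linear uM (cs _ t0)) (volR_linear uM (cs _ ler01)) (volR_linear uM cL').
rewrite (volR_segment_e0 t0 bL').
by ring.
Qed.

End sum_with_segment.

(** * One-dimensional Prekopa-Leindler inequality *)
Section prekopa_leindler.
Context (R : realType).
Notation leb := (@lebesgue_measure R).

Lemma leb_half (c : R) (A : set (measurableTypeR R)) : measurable A ->
  measurable ((fun x => 2 * x + c) @^-1` A) /\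
  leb ((fun x => 2 * x + c) @^-1` A) = (2^-1%:E * leb A)%E.
Proof.
move=> mA; split; last by rewrite lebesgue_measure_affine// normr_nat.
rewrite -[X in measurable X]setTI.
have : measurable_fun setT (fun x : measurableTypeR R => 2 * x + c).
  by apply: measurable_funD => //; exact: mulrl_measurable.
exact.
Qed.

(** Let m = max A and k = min B.  The midpoints of A with k and of m with B lie in
C and have only (m + k) / 2 in common. *)
Lemma leb_midpoint_compact (A B C : set R) : compact A -> compact B ->
  A !=set0 -> B !=set0 -> measurable C ->
  (forall a b, A a -> B b -> C ((a + b) / 2)) ->
  (2^-1%:E * leb A + 2^-1%:E * leb B <= leb C)%E.
Proof.
move=> cA cB A0 B0 mC ABC.
have cid (I : set R) : {within I, continuous (id : R -> R)}.
  by apply: continuous_subspaceT => x; exact: cvg_id.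
have [m' /set_mem Am' Hm'] := compact_EVT_max (f := id) A0 cA (cid _).
have [k' /set_mem Bk' Hk'] := compact_EVT_min (f := id) B0 cB (cid _).
pose m : R := m'; pose k : R := k'.
have Am : A m := Am'; have Bk : B k := Bk'.
have Hm x : A x -> x <= m by move=> Ax; exact/Hm'/mem_set.
have Hk x : B x -> k <= x by move=> Bx; exact/Hk'/mem_set.
have [mA' EA] := leb_half (- k) (compact_measurable cA).
have [mB' EB] := leb_half (- m) (compact_measurable cB).
rewrite -EA -EB.
set A' := _ @^-1` A in mA' *; set B' := _ @^-1` B in mB' *.
pose p : R := (m + k) / 2.
have BD : (leb B' <= leb (B' `\ p))%E.
  rewrite -[leRHS]adde0 -[X in (_ + X)%E](lebesgue_measure_set1 p).
  have mD : measurable (B' `\ p) by exact: measurableD.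
  apply: le_trans (measureU2 _ _ _) => //.
  apply: le_measure; rewrite ?inE//; first exact: measurableU.
  by move=> x Bx; have [->|xmk] := pselect (x = p); [right|left].
apply: (le_trans (leeD2l _ BD)); rewrite -measureU//; last 2 first.
- exact: measurableD.
- rewrite -subset0 => x [/= Ax [Bx nx]]; apply: nx.
  have h1 : (2 * x - k <= m :> R) := Hm _ Ax.
  have h2 : (k <= 2 * x - m :> R) := Hk _ Bx.
  rewrite /p; lra.
apply: le_measure; rewrite ?inE//.
  by apply: measurableU => //; exact: measurableD.
move=> x [|[]] /= h.
  by have := ABC _ _ h Bk; have -> : (2 * x - k + k) / 2 = x by field.
by move=> _; have := ABC _ _ Am h; have -> : (m + (2 * x - m)) / 2 = x by field.
Qed.

Lemma leb_midpoint (A B C : set R) : measurable A -> measurable B -> measurable C ->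
  A !=set0 -> B !=set0 -> (leb A < +oo)%E -> (leb B < +oo)%E ->
  (forall a b, A a -> B b -> C ((a + b) / 2)) ->
  (leb A + leb B <= leb C + leb C)%E.
Proof.
move=> mA mB mC [a Aa] [b Bb] fA fB ABC.
apply/lee_addgt0Pr => e ee.
have e2 : 0 < e / 2 by rewrite divr_gt0.
have approx (D : set R) x : measurable D -> D x -> (leb D < +oo)%E ->
    exists V : set R, [/\ compact V, V x, V `<=` D & (leb D <= leb V + (e / 2)%:E)%E].
  move=> mD Dx fD; have [V [cV VD DV]] := lebesgue_regularity_inner mD fD e2.
  (* x is added to keep the compact set nonempty *)
  exists (V `|` [set x]); split.
  - by apply: compactU => //; exact: compact_set1.
  - by right.
  - by move=> y [/VD //|->].
  - have mV : measurable (V `|` [set x]) by apply: measurableU => //; exact: compact_measurable.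
    have VD' : V `|` [set x] `<=` D by move=> y [/VD //|->].
    have E : D = (V `|` [set x]) `|` (D `\` (V `|` [set x])) by rewrite setDUK.
    rewrite [in leLHS]E measureU ?setDIK//; last exact: measurableD.
    rewrite leeD2l//; apply: ltW; apply: le_lt_trans DV; apply: le_measure; rewrite ?inE.
    + exact: measurableD.
    + by apply: measurableD => //; exact: compact_measurable.
    + by move=> y [Dy nV]; split=> // Vy; apply: nV; left.
have [V [cV Va VA AV]] := approx A a mA Aa fA.
have [W [cW Wb WB BW]] := approx B b mB Bb fB.
have := @leb_midpoint_compact V W C cV cW ltac:(by exists a) ltac:(by exists b) mC
  (fun x y Vx Wy => ABC _ _ (VA _ Vx) (WB _ Wy)).
move=> H; apply: (le_trans (leeD AV BW)).
rewrite addeACA -EFinD -splitr leeD2r//.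
have hh : 2^-1 + 2^-1 = 1 :> R by field.
have := leeD H H; rewrite addeACA -!muleDl//.
  by rewrite -EFinD hh !mul1e.
- by rewrite ge0_fin_numE// compact_finite_measure.
- by rewrite ge0_fin_numE// compact_finite_measure.
Qed.

Definition subgraph (f : R -> R) : set (measurableTypeR R * measurableTypeR R) :=
  [set p | 0 <= p.2 < f p.1].

Lemma measurable_subgraph (f : R -> R) :
  measurable_fun setT (f : measurableTypeR R -> measurableTypeR R) ->
  measurable (subgraph f).
Proof.
move=> mf.
rewrite [subgraph f](_ : _ =
  (fun p : measurableTypeR R * measurableTypeR R => 0 <= p.2) @^-1` [set true] `&`
  (fun p : measurableTypeR R * measurableTypeR R => p.2 < f p.1) @^-1` [set true]); last first.
  by apply/seteqP; split => p /= => [/andP//|[? ?]]; exact/andP.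
apply: measurableI; rewrite -[X in measurable X]setTI.
  by apply: measurable_fun_ler.
by apply: measurable_fun_ltr => //; exact: measurableT_comp.
Qed.

Lemma ysection_subgraph (f : R -> R) t :
  ysection (subgraph f) t = [set x | 0 <= t < f x].
Proof. by apply/seteqP; split=> x; rewrite /ysection /= inE. Qed.

Lemma measurable_leb_superlevel (f : R -> R) :
  measurable_fun setT (f : measurableTypeR R -> measurableTypeR R) ->
  measurable_fun setT (fun t : measurableTypeR R => leb [set x | 0 <= t < f x]).
Proof.
move=> /measurable_subgraph/(measurable_fun_ysection leb).
by apply: eq_measurable_fun => t _ /=; rewrite ysection_subgraph.
Qed.

(** Fubini for the region below the graph of f. *)
Lemma integral_superlevel (f : R -> R) :
  measurable_fun setT (f : measurableTypeR R -> measurableTypeR R) ->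
  (forall x, 0 <= f x) ->
  (\int[leb]_x (f x)%:E = \int[leb]_t leb [set x | (0 <= t < f x)%R])%E.
Proof.
move=> mf f0.
have mU := measurable_subgraph mf.
have := indic_fubini_tonelli leb leb mU.
rewrite indic_fubini_tonelli_FE // indic_fubini_tonelli_GE //= => E.
transitivity (\int[leb]_x leb (xsection (subgraph f) x))%E.
  apply: eq_integral => x _.
  have -> : xsection (subgraph f) x = `[0, f x[%classic.
    by apply/seteqP; split=> t; rewrite /xsection /= inE /subgraph /= in_itv.
  rewrite lebesgue_measure_itv /= lte_fin.
  by case: ltgtP (f0 x) => // [_|<-] _; rewrite ?sube0.
rewrite E; by apply: eq_integral => t _ /=; rewrite ysection_subgraph.
Qed.

(** When f and g both have supremum 1, each superlevel set of h at a height t < 1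
contains the midpoints of two nonempty superlevel sets of f and g, so the measures
can be compared height by height. *)
Lemma prekopa_leindler_sup1 (r : R) (f g h : R -> R) :
  measurable_fun setT (f : measurableTypeR R -> measurableTypeR R) ->
  measurable_fun setT (g : measurableTypeR R -> measurableTypeR R) ->
  measurable_fun setT (h : measurableTypeR R -> measurableTypeR R) ->
  (forall x, 0 <= f x <= 1) -> (forall x, 0 <= g x <= 1) -> (forall x, 0 <= h x) ->
  (forall x, r < `|x| -> f x = 0) -> (forall x, r < `|x| -> g x = 0) ->
  (forall t, t < 1 -> exists x, t < f x) ->
  (forall t, t < 1 -> exists x, t < g x) ->
  (forall t x y, t < f x -> t < g y -> t < h ((x + y) / 2)) ->
  (\int[leb]_x (f x)%:E + \int[leb]_x (g x)%:E <=
   \int[leb]_x (h x)%:E + \int[leb]_x (h x)%:E)%E.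
Proof.
move=> mf mg mh f01 g01 h0 fr gr f1 g1 fgh.
have f0 x : 0 <= f x by case/andP: (f01 x).
have g0 x : 0 <= g x by case/andP: (g01 x).
have mlev (u : R -> R) : measurable_fun setT (u : measurableTypeR R -> measurableTypeR R) ->
    forall t, measurable ([set x | 0 <= t < u x] : set (measurableTypeR R)).
  move=> mu t; have [t0|t0] := leP 0 t; last first.
    rewrite [X in measurable X](_ : _ = set0) //.
    by apply/seteqP; split=> x //=.
  rewrite -[X in measurable X]setTI.
  rewrite [X in measurable (_ `&` X)](_ : _ = u @^-1` `]t, +oo[%classic).
    by apply: mu.
  by apply/seteqP; split=> x /=; rewrite in_itv /= andbT.
have ml := measurable_leb_superlevel.
rewrite !integral_superlevel// -!ge0_integralD//; do ?exact: ml.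
apply: ge0_le_integral => //.
- by move=> x _; rewrite adde_ge0.
- by apply: emeasurable_funD; exact: ml.
- by apply: emeasurable_funD; exact: ml.
move=> t _; have [t0|t0] : t < 0 \/ 0 <= t by case: (ltP t 0); [left|right].
  have E (u : R -> R) : leb [set x | 0 <= t < u x] = 0%E.
    rewrite -[RHS](measure0 leb); congr (leb _).
    by apply/seteqP; split=> x //=; rewrite leNgt t0.
  by rewrite /= !E.
have [t1|t1] := leP 1 t.
  have E (u : R -> R) : (forall x, 0 <= u x <= 1) -> leb [set x | 0 <= t < u x] = 0%E.
    move=> u1; rewrite -[RHS](measure0 leb); congr (leb _).
    apply/seteqP; split=> x //= /andP[_ tu].
    have /andP[_ ux] := u1 x; by have := lt_le_trans tu (le_trans ux t1); rewrite ltxx.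
  by rewrite /= (E _ f01) (E _ g01) adde0 adde_ge0.
have fin (u : R -> R) : (forall x, r < `|x| -> u x = 0) ->
    measurable ([set x | 0 <= t < u x] : set (measurableTypeR R)) ->
    (leb [set x | (0 <= t < u x)%R] < +oo)%E.
  move=> ur mu; apply: (@le_lt_trans _ _ (leb `[- r, r]%classic)).
    apply: le_measure; rewrite ?inE// => x /= /andP[_ tu].
    rewrite in_itv /= -ler_norml leNgt; apply: contraTN tu => /ur ->.
    by rewrite -leNgt.
  by rewrite lebesgue_measure_itv /=; case: ifP => _; rewrite -?EFinB ltry.
apply: leb_midpoint; do ?[exact: mlev].
- by have [x xt] := f1 t t1; exists x; rewrite /= t0.
- by have [x xt] := g1 t t1; exists x; rewrite /= t0.
- by apply: fin => //; exact: mlev.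
- by apply: fin => //; exact: mlev.
- by move=> a b /= /andP[_ ta] /andP[_ tb]; rewrite t0 fgh.
Qed.

(** Dividing f and g by their suprema s and t, and h by sqrt(s t), reduces to
suprema equal to 1; the arithmetic mean of the normalized integrals then bounds
their geometric mean. *)
Lemma prekopa_leindler (r a b : R) (f g h : R -> R) (If Ig Ih : R) :
  measurable_fun setT (f : measurableTypeR R -> measurableTypeR R) ->
  measurable_fun setT (g : measurableTypeR R -> measurableTypeR R) ->
  measurable_fun setT (h : measurableTypeR R -> measurableTypeR R) ->
  (forall x, 0 <= f x <= a) -> (forall x, 0 <= g x <= b) -> (forall x, 0 <= h x) ->
  (forall x, r < `|x| -> f x = 0) -> (forall x, r < `|x| -> g x = 0) ->
  (forall x y, f x * g y <= h ((x + y) / 2) ^+ 2) ->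
  (\int[leb]_x (f x)%:E = If%:E)%E ->
  (\int[leb]_x (g x)%:E = Ig%:E)%E ->
  (\int[leb]_x (h x)%:E = Ih%:E)%E ->
  If * Ig <= Ih ^+ 2.
Proof.
move=> mf mg mh f0a g0b h0 fr gr fgh EIf EIg EIh.
have sup_spec (u : R -> R) c (x0 : R) : (forall x, 0 <= u x <= c) -> u x0 != 0 ->
    exists2 s, 0 < s & (forall x, u x <= s) /\ (forall t, t < s -> exists x, t < u x).
  move=> u0c ux0.
  have hs : has_sup (range u).
    by split; [exists (u x0), x0|exists c => _ [x _ <-]; case/andP: (u0c x)].
  have ub x : u x <= sup (range u) by apply: ub_le_sup; [case: hs|exists x].
  exists (sup (range u)).
    apply: lt_le_trans (ub x0); rewrite lt_neqAle eq_sym ux0.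
    by case/andP: (u0c x0).
  split=> // t; rewrite -subr_gt0 => ts; have [_ [x _ <-]] := sup_adherent ts hs.
  by rewrite subKr; exists x.
have int0 (u : R -> R) I : (forall x, u x = 0) -> (\int[leb]_x (u x)%:E = I%:E)%E -> I = 0.
  move=> u0; rewrite integral0_eq => [[]//|x _]; by rewrite u0.
have [f0|/existsNP[x0 /eqP fx0]] := pselect (forall x, f x = 0).
  by rewrite (int0 f If)// mul0r sqr_ge0.
have [g0|/existsNP[y0 /eqP gy0]] := pselect (forall x, g x = 0).
  by rewrite (int0 g Ig)// mulr0 sqr_ge0.
have [s s0 [fs fS]] := sup_spec f a x0 f0a fx0.
have [t t0 [gt gT]] := sup_spec g b y0 g0b gy0.
pose c := Num.sqrt (s * t).
have c0 : 0 < c by rewrite sqrtr_gt0 mulr_gt0.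
have c2 : c ^+ 2 = s * t by rewrite sqr_sqrtr// ltW ?mulr_gt0.
have scale (u : R -> R) k I : 0 < k -> (forall x, 0 <= u x) ->
    measurable_fun setT (u : measurableTypeR R -> measurableTypeR R) ->
    (\int[leb]_x (u x)%:E = I%:E)%E -> (\int[leb]_x (k^-1 * u x)%:E = (k^-1 * I)%:E)%E.
  move=> k0 u0 mu EI; rewrite EFinM -EI -ge0_integralZl//.
  - by apply/measurable_EFinP.
  - by move=> x _; rewrite lee_fin.
  - by rewrite lee_fin invr_ge0 ltW.
have msc (u : R -> R) k : measurable_fun setT (u : measurableTypeR R -> measurableTypeR R) ->
    measurable_fun setT ((fun x => k^-1 * u x) : measurableTypeR R -> measurableTypeR R).
  by move=> mu; apply: measurable_funM.
have f0 x : 0 <= f x by case/andP: (f0a x).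
have g0 x : 0 <= g x by case/andP: (g0b x).
have := @prekopa_leindler_sup1 r _ _ _ (msc f s mf) (msc g t mg) (msc h c mh).
rewrite (scale f s If)// (scale g t Ig)// (scale h c Ih)//.
rewrite -!EFinD lee_fin => H.
have {H}: s^-1 * If + t^-1 * Ig <= c^-1 * Ih + c^-1 * Ih.
  apply: H.
  - move=> x; rewrite mulr_ge0 ?invr_ge0 ?(ltW s0)//=.
    by rewrite mulrC ler_pdivrMr// mul1r.
  - move=> x; rewrite mulr_ge0 ?invr_ge0 ?(ltW t0)//=.
    by rewrite mulrC ler_pdivrMr// mul1r.
  - by move=> x; rewrite mulr_ge0 ?invr_ge0 ?(ltW c0).
  - by move=> x /fr ->; rewrite mulr0.
  - by move=> x /gr ->; rewrite mulr0.
  - move=> w w1; have [x] := fS (w * s) ltac:(by rewrite -[ltRHS]mul1r ltr_pM2r).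
    by exists x; rewrite mulrC ltr_pdivlMr.
  - move=> w w1; have [x] := gT (w * t) ltac:(by rewrite -[ltRHS]mul1r ltr_pM2r).
    by exists x; rewrite mulrC ltr_pdivlMr.
  - move=> w x y; rewrite ![_^-1 * _]mulrC !ltr_pdivlMr// => wf wg.
    have [w0|w0] := leP 0 w; last by apply: lt_le_trans (h0 _); rewrite nmulr_rlt0.
    have wc : 0 <= w * c by rewrite mulr_ge0// ltW.
    rewrite -(ltr_pXn2r (n := 2)) ?nnegrE ?h0//; apply: lt_le_trans (fgh x y).
    rewrite exprMn c2 expr2 mulrACA.
    by apply: ltr_pM => //; rewrite mulr_ge0// ltW.
have I0 (u : R -> R) I : (forall x, 0 <= u x) -> (\int[leb]_x (u x)%:E = I%:E)%E -> 0 <= I.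
  by move=> u0 EI; rewrite -lee_fin -EI; apply: integral_ge0 => x _; rewrite lee_fin.
have If0 := I0 f If f0 EIf; have Ig0 := I0 g Ig g0 EIg; have Ih0 := I0 h Ih h0 EIh.
move=> H.
have : (s^-1 * If + t^-1 * Ig) ^+ 2 <= (c^-1 * Ih + c^-1 * Ih) ^+ 2.
  have iv k : 0 < k -> 0 <= k^-1 by move=> k0; rewrite invr_ge0 ltW.
  by apply: lerXn2r H; rewrite nnegrE addr_ge0// mulr_ge0// iv.
have -> : (c^-1 * Ih + c^-1 * Ih) ^+ 2 = 4 * Ih ^+ 2 / (s * t).
  rewrite -c2; field; exact: lt0r_neq0.
rewrite ler_pdivlMr ?mulr_gt0//.
have : 0 <= (s^-1 * If - t^-1 * Ig) ^+ 2 * (s * t) by rewrite mulr_ge0 ?sqr_ge0 ?ltW ?mulr_gt0.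
have -> : (s^-1 * If - t^-1 * Ig) ^+ 2 * (s * t) =
  (s^-1 * If + t^-1 * Ig) ^+ 2 * (s * t) - 4 * (If * Ig).
  by field; rewrite !lt0r_neq0.
lra.
Qed.

End prekopa_leindler.

(** * Midpoint Brunn-Minkowski inequality *)
Section brunn_minkowski.
Context (R : realType).
Notation leb := (@lebesgue_measure R).

Lemma slice_bounded n (A : set 'rV[R]_n.+1) : compact A -> exists r, forall a y,
  slice A a y -> `|a| <= r /\ forall i, `|y 0 i| <= r.
Proof.
move=> cA; have [M [_ HM]] := compact_bounded cA.
have M1 : M < M + 1 by rewrite ltrDl.
exists (M + 1) => a y /(HM _ M1) H.
split=> [|i].
  apply: le_trans (le_trans (coord_le_norm _ (@lshift 1 n 0)) H).
  by rewrite [X in _ <= `|X|]row_mxEl mxE eqxx mulr1n.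
apply: le_trans (le_trans (coord_le_norm _ (@rshift 1 n i)) H).
by rewrite [X in _ <= `|X|]row_mxEr.
Qed.

Lemma compact_slice n (A : set 'rV[R]_n.+1) a : compact A -> compact (slice A a).
Proof.
move=> cA; have [r Hr] := slice_bounded cA.
apply: bounded_closed_compact.
  exists `|r|; split=> // s rs y Ay; have [_ yr] := Hr a y Ay.
  apply: norm_le_coord => [|i]; first by rewrite (le_trans _ (ltW rs)).
  by rewrite (le_trans (yr i))// (le_trans (ler_norm r))// ltW.
apply: (@preimage_closed _ _ (fun y => (row_mx a%:M y : 'rV_(1 + n)))); last first.
  by apply: compact_closed cA; exact: norm_hausdorff.
have cont : continuous (fun y : 'rV[R]_n => row_mx a%:M y : 'rV[R]_(1 + n)).
  have -> : (fun y : 'rV[R]_n => row_mx a%:M y : 'rV[R]_(1 + n)) =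
      (fun y => (row_mx a%:M 0 : 'rV_(1 + n)) + y *m (row_mx 0 1%:M)).
    by apply/funext => y; rewrite mul_mx_row mulmx0 mulmx1 add_row_mx addr0 add0r.
  by move=> x; apply: cvgD (@mulmxr_continuous R _ _ _ x); exact: cvg_cst.
by move=> x _; exact: cont.
Qed.

Lemma integral_volR_slice n (A : set 'rV[R]_n.+1) : compact A ->
  (\int[leb]_a (volR (slice A a))%:E = (volR A)%:E)%E.
Proof.
move=> cA; rewrite -(volRE cA) vol_slice.
apply: eq_integral => a _; rewrite volRE//; exact: compact_slice.
Qed.

Lemma measurable_volR_slice n (A : set 'rV[R]_n.+1) : compact A ->
  measurable_fun setT ((fun a => volR (slice A a)) : measurableTypeR R -> measurableTypeR R).
Proof.
move=> cA; apply: (measurableT_comp (@fine_measurable R setT measurableT)).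
by apply: measurable_vol_slice; exact: borel_compact.
Qed.

Lemma volR_slice_bounded n (A : set 'rV[R]_n.+1) : compact A -> exists r m,
  (forall a, 0 <= volR (slice A a) <= m) /\ (forall a, r < `|a| -> volR (slice A a) = 0).
Proof.
move=> cA; have [r Hr] := slice_bounded cA.
exists r, (volR [set x : 'rV[R]_n | forall i, `|x 0 i| <= r]); split=> a.
  rewrite volR_ge0; apply: le_volR; [exact: compact_slice|exact: compact_box|].
  by move=> y /Hr[].
move=> ra; rewrite /volR; have -> : slice A a = set0; last first.
  by rewrite /vol preimage_set0 measure0.
by apply/seteqP; split=> y // /Hr[]; rewrite leNgt ra.
Qed.

(** The slice of C at (x + y) / 2 contains the midpoints of the slices of A at x
and of B at y, so the induction hypothesis is the assumption of
[prekopa_leindler] for the volumes of the slices. *)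
Theorem brunn_minkowski_midpoint n (A B C : set 'rV[R]_n) :
  compact A -> compact B -> compact C ->
  (forall a b, A a -> B b -> C (2^-1 *: (a + b))) ->
  volR A * volR B <= volR C ^+ 2.
Proof.
elim: n A B C => [|n IH] A B C cA cB cC ABC.
  have E (S : set 'rV[R]_0) : volR S = \1_(@row_of R 0 @^-1` S) tt.
    rewrite /volR; have -> // : vol S = (\1_(@row_of R 0 @^-1` S) tt)%:E.
    by rewrite /vol /= diracE indicE.
  rewrite !E !indicE -natrM -natrX ler_nat.
  case: (boolP (_ \in _ @^-1` A)) => [/set_mem A0|]; last by rewrite mul0n.
  case: (boolP (_ \in _ @^-1` B)) => [/set_mem B0|]; last by rewrite muln0.
  rewrite mem_set//=; have := ABC _ _ A0 B0.
  by rewrite /= addr0 scaler0.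
have [rA [mA [fA f0]]] := volR_slice_bounded cA.
have [rB [mB [gB g0]]] := volR_slice_bounded cB.
apply: (@prekopa_leindler R (Num.max rA rB) mA mB (fun a => volR (slice A a))
  (fun a => volR (slice B a)) (fun a => volR (slice C a))); rewrite ?integral_volR_slice//.
- exact: measurable_volR_slice.
- exact: measurable_volR_slice.
- exact: measurable_volR_slice.
- by move=> x; exact: volR_ge0.
- by move=> x; rewrite gt_max => /andP[/f0].
- by move=> x; rewrite gt_max => /andP[_ /g0].
move=> x y; apply: IH; [exact: compact_slice..|].
move=> a b Aa Bb; have := ABC _ _ Aa Bb.
rewrite /slice /= scalerDr [X in C X]row_mx_scalar_comb -mulrDr -[_ *: a + _]scalerDr.
by rewrite mulrC.
Qed.

End brunn_minkowski.

(** * Euclidean geometry of row vectors *)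
Section euclidean_geometry.
Context (R : realType) (n : nat).
Implicit Types x y u v : 'rV[R]_n.

Definition dot x y : R := \sum_i x 0 i * y 0 i.

Lemma dotE x y : dot x y = (x *m y^T) 0 0.
Proof. by rewrite mxE; apply: eq_bigr => i _; rewrite mxE. Qed.

Lemma dotC x y : dot x y = dot y x.
Proof. by apply: eq_bigr => i _; rewrite mulrC. Qed.

Lemma dotDl x y z : dot (x + y) z = dot x z + dot y z.
Proof. by rewrite -big_split; apply: eq_bigr => i _; rewrite mxE mulrDl. Qed.

Lemma dotZl a x z : dot (a *: x) z = a * dot x z.
Proof. by rewrite mulr_sumr; apply: eq_bigr => i _; rewrite mxE mulrA. Qed.

Lemma dotDr x y z : dot x (y + z) = dot x y + dot x z.
Proof. by rewrite dotC dotDl !(dotC x). Qed.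

Lemma dotZr a x z : dot x (a *: z) = a * dot x z.
Proof. by rewrite dotC dotZl dotC. Qed.

Lemma dotBl x y z : dot (x - y) z = dot x z - dot y z.
Proof. by rewrite dotDl -scaleN1r dotZl mulN1r. Qed.

Lemma dotBr x y z : dot x (y - z) = dot x y - dot x z.
Proof. by rewrite dotC dotBl !(dotC x). Qed.

Lemma dot0l x : dot 0 x = 0.
Proof. by rewrite -(scale0r 0) dotZl mul0r. Qed.

Lemma dotxx_ge0 x : 0 <= dot x x.
Proof. by apply: sumr_ge0 => i _; rewrite -expr2 sqr_ge0. Qed.

Lemma norm2E x : norm2 x = Num.sqrt (dot x x).
Proof. by congr Num.sqrt; apply: eq_bigr => i _; rewrite expr2. Qed.

Lemma sqr_norm2 x : norm2 x ^+ 2 = dot x x.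
Proof. by rewrite norm2E sqr_sqrtr// dotxx_ge0. Qed.

Lemma norm2_ge0 x : 0 <= norm2 x.
Proof. exact: sqrtr_ge0. Qed.

Lemma norm2Z a x : norm2 (a *: x) = `|a| * norm2 x.
Proof.
by rewrite !norm2E dotZl dotZr mulrA -expr2 sqrtrM ?sqr_ge0// sqrtr_sqr.
Qed.

Lemma norm2_coord x i : `|x 0 i| <= norm2 x.
Proof.
rewrite -sqrtr_sqr norm2E ler_wsqrtr// /dot (bigD1 i)//= -expr2 lerDl.
by apply: sumr_ge0 => j _; rewrite -expr2 sqr_ge0.
Qed.

Lemma dotxx_eq0 x : dot x x = 0 -> x = 0.
Proof.
move=> x0; apply/rowP => i; rewrite mxE; apply/eqP; rewrite -normr_le0.
by apply: le_trans (norm2_coord x i) _; rewrite norm2E x0 sqrtr0.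
Qed.

Lemma norm2_eq0 x : norm2 x = 0 -> x = 0.
Proof. by move=> x0; apply: dotxx_eq0; rewrite -sqr_norm2 x0 expr0n. Qed.

Lemma norm20 : norm2 (0 : 'rV[R]_n) = 0.
Proof. by rewrite norm2E dot0l sqrtr0. Qed.

(** Expand |(y.y) x - (x.y) y|^2 >= 0. *)
Lemma cauchy_schwarz x y : `|dot x y| <= norm2 x * norm2 y.
Proof.
rewrite -(ler_pXn2r (n := 2)) ?nnegrE ?mulr_ge0 ?norm2_ge0//.
rewrite exprMn !sqr_norm2 real_normK ?num_real//.
have [->|y0] := eqVneq y 0.
  by rewrite dotC !dot0l expr0n mulr0.
have yp : 0 < dot y y.
  by rewrite lt_neqAle dotxx_ge0 andbT eq_sym; apply: contra_neq y0; exact: dotxx_eq0.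
have := dotxx_ge0 (dot y y *: x - dot x y *: y).
have -> : dot (dot y y *: x - dot x y *: y) (dot y y *: x - dot x y *: y) =
   dot y y * (dot x x * dot y y - dot x y ^+ 2).
  by rewrite !dotBl !dotBr !dotZl !dotZr (dotC y x); ring.
by rewrite pmulr_rge0// subr_ge0.
Qed.

Lemma ler_norm2D x y : norm2 (x + y) <= norm2 x + norm2 y.
Proof.
rewrite -(ler_pXn2r (n := 2)) ?nnegrE ?addr_ge0 ?norm2_ge0//.
rewrite sqrrD !sqr_norm2 dotDl !dotDr (dotC y x).
have := le_trans (ler_norm _) (cauchy_schwarz x y); lra.
Qed.

Lemma norm2_le_sum x : norm2 x <= \sum_i `|x 0 i|.
Proof.
rewrite -(ler_pXn2r (n := 2)) ?nnegrE ?norm2_ge0 ?sumr_ge0//.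
rewrite sqr_norm2 /dot expr2 mulr_suml ler_sum// => i _.
rewrite -[x 0 i * _]ger0_norm -?expr2 ?sqr_ge0// normrX expr2 ler_wpM2l//.
by rewrite (bigD1 i)//= lerDl sumr_ge0.
Qed.

Lemma norm2_le_sup x r : (forall i, `|x 0 i| <= r) -> norm2 x <= n%:R * r.
Proof.
move=> H; apply: (le_trans (norm2_le_sum x)).
apply: le_trans (ler_sum _ (fun i _ => H i)) _.
by rewrite sumr_const card_ord mulr_natl.
Qed.

Lemma continuous_dotxx : continuous (fun x => dot x x).
Proof.
apply: continuous_big => [|i _ y]; first exact: add_continuous.
have c : {for y, continuous (fun x : 'rV[R]_n => x 0 i : R)}.
  exact: (@coord_continuous R 1 n 0 i y).
exact: (cvgM c c).
Qed.

Lemma unit_ballE : unit_ball R n = [set x | dot x x <= 1].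
Proof.
apply/seteqP; split=> x /=; rewrite /unit_ball/= -sqr_norm2 => H.
  by rewrite expr_le1// norm2_ge0.
by rewrite -(@expr_le1 _ 2)// norm2_ge0.
Qed.

Lemma body_unit_ball : body (unit_ball R n).
Proof.
split.
- by exists 0; rewrite /unit_ball /= norm20.
- apply: bounded_closed_compact.
    exists 1; split=> // r r1 x x1; apply: norm_le_coord => [|i].
      by rewrite ltW// (lt_trans _ r1).
    by rewrite (le_trans (norm2_coord _ _))// (le_trans x1)// ltW.
  rewrite unit_ballE; apply: (@preimage_closed _ _ (fun x => dot x x) [set r | r <= 1]).
    by move=> x _; exact: continuous_dotxx.
  exact: closed_le.
- move=> x y s t; rewrite /unit_ball /= => x1 y1 s0 t0 st.
  apply: le_trans (ler_norm2D _ _) _; rewrite !norm2Z !ger0_norm// -st lerD//;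
    by rewrite -[leRHS]mulr1 ler_wpM2l.
Qed.

Lemma dilate_ballP r x : 0 < r -> dilate r (unit_ball R n) x <-> norm2 x <= r.
Proof.
move=> r0; split=> [[y y1 <-]|xr].
  by rewrite norm2Z gtr0_norm// -[leRHS]mulr1 ler_wpM2l// ltW.
exists (r^-1 *: x); last by rewrite scalerA mulfV ?gt_eqF// scale1r.
by rewrite /unit_ball /= norm2Z gtr0_norm ?invr_gt0// mulrC ler_pdivrMr// mul1r.
Qed.

(** The reflection exchanging x and y. *)
Lemma householder x y : dot x x = dot y y ->
  exists2 Q : 'M[R]_n, Q *m Q^T = 1%:M & x *m Q = y.
Proof.
move=> xy; have [->|xny] := eqVneq x y.
  by exists 1%:M; rewrite ?mul1mx ?trmx1 ?mulmx1.
pose w := x - y.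
have w0 : dot w w != 0.
  by apply: contra_neq xny => /dotxx_eq0/eqP; rewrite subr_eq0 => /eqP.
pose Q := 1%:M - (2 / dot w w) *: (w^T *m w).
have QT : Q^T = Q by rewrite linearB linearZ /= trmx1 trmx_mul trmxK.
have ww : w *m w^T = (dot w w)%:M by rewrite [LHS]mx11_scalar dotE.
exists Q.
  rewrite QT /Q; set P := w^T *m w; set k := 2 / dot w w.
  have PP : P *m P = dot w w *: P.
    by rewrite /P mulmxA -[w^T *m w *m w^T]mulmxA ww mul_mx_scalar -scalemxAl.
  rewrite mulmxBl mul1mx mulmxBr mulmx1 -scalemxAl -scalemxAr PP !scalerA.
  have -> : k * k * dot w w = 2 * k by rewrite /k; field.
  by apply/matrixP => i j; rewrite !mxE; ring.
have xw : 2 / dot w w * dot x w = 1.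
  have -> : dot x w = dot w w / 2.
    by rewrite /w !dotBl !dotBr (dotC y x) -xy; field.
  by field.
rewrite /Q mulmxBr mulmx1 -scalemxAr mulmxA [x *m w^T]mx11_scalar -dotE.
by rewrite mul_scalar_mx scalerA xw scale1r /w opprB subrKC.
Qed.

End euclidean_geometry.

(** * Zonotopes and their support functions *)
Section zonotopes.
Context (R : realType) (n : nat).
Implicit Types (x v : 'rV[R]_n) (vs : seq 'rV[R]_n).

Definition sym_segment v : set 'rV[R]_n := [set s *: v | s in `[-1, 1]%classic].

(** The symmetric segments [-v, v] make the support function a sum of absolute
values. *)
Definition zonotope vs : set 'rV[R]_n :=
  foldr (fun v Z => msum Z (sym_segment v)) [set 0] vs.

Definition zonotope_support vs x : R := \sum_(v <- vs) `|dot v x|.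

(** Up to a translation, t [-v, v] is the segment [0, t (2 v)]. *)
Lemma dilate_sym_segment t v : 0 <= t ->
  dilate t (sym_segment v) = msum (segment t (2 *: v)) [set - t *: v].
Proof.
move=> t0; apply/seteqP; split.
  move=> _ [_ [s + <-] <-]; rewrite /= in_itv /= => /andP[s1 s2].
  exists ((t * (s + 1) / 2) *: (2 *: v)).
    exists (t * (s + 1) / 2) => //=; rewrite in_itv /= divr_ge0 ?mulr_ge0//=; last by lra.
    by rewrite ler_pdivrMr// ler_wpM2l//; lra.
  by exists (- t *: v) => //; rewrite !scalerA -scalerDl; congr (_ *: _); field.
move=> _ [_ [s + <-] [_ -> <-]]; rewrite /= in_itv /= => /andP[s1 s2].
(* in the degenerate case t = 0 the parameter 2 s / t - 1 is meaningless *)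
have [E|tn0] := eqVneq t 0.
  exists (0 *: v); first by exists 0 => //=; rewrite in_itv /= lerN10 ler01.
  have -> : s = 0 by apply/eqP; rewrite eq_le s1 andbT -E.
  by rewrite E oppr0 !scale0r addr0.
exists ((2 * s / t - 1) *: v).
  exists (2 * s / t - 1) => //=; rewrite in_itv /=.
  have tp : 0 < t by rewrite lt_neqAle eq_sym tn0.
  rewrite lerBrDr addNr divr_ge0 ?mulr_ge0//= lerBlDr ler_pdivrMr//; lra.
by rewrite !scalerA -scalerDl; congr (_ *: _); field.
Qed.

Lemma body_sym_segment v : body (sym_segment v).
Proof.
rewrite -[sym_segment v]dilate1 dilate_sym_segment//; apply: body_msum.
  exact: body_segment.
exact: body_set1.
Qed.

Lemma body_zonotope vs : body (zonotope vs).
Proof.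
elim: vs => [|v vs IH] /=; first exact: body_set1.
exact: body_msum (body_sym_segment v).
Qed.

Lemma dot_zonotope_le vs x z : zonotope vs z -> dot z x <= zonotope_support vs x.
Proof.
rewrite /zonotope_support; elim: vs z => [|v vs IH] z /=.
  by move=> ->; rewrite dot0l big_nil.
move=> [y /IH yx [_ [s + <-] <-]]; rewrite /= in_itv /= -ler_norml => s1.
rewrite big_cons dotDl addrC lerD// dotZl (le_trans (ler_norm _))// normrM.
by rewrite ler_piMl.
Qed.

Lemma zonotope_support_attained vs x :
  exists2 z, zonotope vs z & dot z x = zonotope_support vs x.
Proof.
rewrite /zonotope_support; elim: vs => [|v vs [z Zz zx]] /=.
  by exists 0; rewrite ?dot0l ?big_nil.
exists (z + Num.sg (dot v x) *: v).
  exists z => //; exists (Num.sg (dot v x) *: v) => //; exists (Num.sg (dot v x)) => //=.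
  rewrite in_itv /= -ler_norml normr_sg; by case: (_ != 0).
by rewrite big_cons dotDl dotZl zx addrC [in RHS]normrEsg.
Qed.

Lemma zonotope_sub_ball vs r : 0 < r ->
  (forall x, zonotope_support vs x <= r * norm2 x) ->
  zonotope vs `<=` dilate r (unit_ball R n).
Proof.
move=> r0 H z Zz; apply/dilate_ballP => //.
have := le_trans (dot_zonotope_le z Zz) (H z); rewrite -sqr_norm2 expr2.
have [->|z0] := eqVneq (norm2 z) 0; first by move=> _; exact: ltW.
by rewrite ler_pM2r// lt_neqAle eq_sym z0 norm2_ge0.
Qed.

(** The point z of Z nearest to p: moving from z towards y by the fraction
s = d / (d + q) would come closer to p if d = <p - z, y - z> were positive. *)
Lemma nearest_point (Z : set 'rV[R]_n) p : body Z ->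
  exists2 z, Z z & forall y, Z y -> dot (p - z) (y - z) <= 0.
Proof.
move=> [Z0 cZ vZ].
have cf : {within Z, continuous (fun y => dot (p - y) (p - y))}.
  apply: continuous_subspaceT => y.
  have c : {for y, continuous (fun y : 'rV[R]_n => p - y)}.
    by apply: continuousB => //; exact: cst_continuous.
  exact: (continuous_comp c (@continuous_dotxx R n (p - y))).
have [z /set_mem Zz Hz] := compact_EVT_min Z0 cZ cf.
exists z => // y Zy; rewrite leNgt; apply/negP => dpos.
set d := dot _ _ in dpos.
pose q := dot (y - z) (y - z).
have q0 : 0 <= q by exact: dotxx_ge0.
pose s := d / (d + q).
have dq : 0 < d + q by rewrite ltr_wpDr.
have s0 : 0 < s by rewrite divr_gt0.
have s1 : s <= 1 by rewrite ler_pdivrMr// mul1r lerDl.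
have Zw : Z ((1 - s) *: z + s *: y).
  by apply: vZ => //; [rewrite subr_ge0|exact: ltW|rewrite subrK].
have := Hz _ (mem_set Zw).
have -> : p - ((1 - s) *: z + s *: y) = (p - z) - s *: (y - z).
  by rewrite scalerBl scale1r scalerBr; apply/rowP => i; rewrite !mxE; ring.
have -> : dot (p - z - s *: (y - z)) (p - z - s *: (y - z)) =
    dot (p - z) (p - z) - s * (2 * d - s * q).
  rewrite (dotBl (p - z)) !(dotBr _ (p - z)) !dotZl !dotZr (dotC (y - z) (p - z)) -/d -/q.
  by ring.
rewrite lerBrDr gerDl -ler_pdivlMl// mulr0 subr_le0 => h.
have : s * q <= d.
  have d0 := ltW dpos.
  by rewrite /s mulrAC ler_pdivrMr// ler_wpM2l// lerDr.
lra.
Qed.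

(** A point p outside the zonotope would be separated from it by the hyperplane
through its nearest point z and orthogonal to p - z, in contradiction with the
lower bound on the support function in the direction p - z. *)
Lemma ball_sub_zonotope vs r : 0 < r ->
  (forall x, r * norm2 x <= zonotope_support vs x) ->
  dilate r (unit_ball R n) `<=` zonotope vs.
Proof.
move=> r0 H p /(dilate_ballP _ r0) pr.
have [z Zz Hz] := nearest_point p (body_zonotope vs).
have [y Zy Ey] := zonotope_support_attained vs (p - z).
have := Hz _ Zy; rewrite dotBr (dotC _ y) Ey.
have [/norm2_eq0/eqP|d0] := eqVneq (norm2 (p - z)) 0.
  by rewrite subr_eq0 => /eqP ->.
have dp : 0 < norm2 (p - z) by rewrite lt_neqAle eq_sym d0 norm2_ge0.
have h1 := H (p - z).
have h2 : dot (p - z) z = dot (p - z) p - norm2 (p - z) ^+ 2.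
  by rewrite sqr_norm2 dotBr; ring.
have h3 := le_trans (ler_norm _) (cauchy_schwarz (p - z) p).
have h4 : norm2 (p - z) * norm2 p <= r * norm2 (p - z) by rewrite mulrC ler_wpM2r// norm2_ge0.
have h5 : 0 < norm2 (p - z) ^+ 2 by rewrite exprn_gt0.
by move=> h0; exfalso; lra.
Qed.

End zonotopes.

(** * The ball is a limit of zonotopes *)
Section ball_is_zonoid.
Context (R : realType).

Notation mu n := (ms_mu (lebesgue_space R n)).
Notation pre_ball n := (@row_of R n @^-1` unit_ball R n).

Lemma measurable_abs_dot n x D : measurable_fun D (fun p => `|dot (@row_of R n p) x|%:E).
Proof.
apply/measurable_EFinP; apply: measurableT_comp => //.
apply: measurable_funS (@measurableT _ _) (subsetT _) _.
by apply: measurable_sum => i; apply: measurable_funM => //; exact: measurable_coord.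
Qed.

Definition dot_integral n A x : \bar R := (\int[mu n]_(p in A) `|dot (row_of p) x|%:E)%E.

Lemma measurable_pre_ball n : measurable (pre_ball n).
Proof. by apply: borel_compact; case: (body_unit_ball R n). Qed.

Lemma dot_mulmx n (Q : 'M[R]_n) x y : dot x (y *m Q) = dot (x *m Q^T) y.
Proof. by rewrite !dotE trmx_mul mulmxA. Qed.

Lemma dot_integral_rot n (Q : 'M[R]_n) x : Q *m Q^T = 1%:M ->
  dot_integral (pre_ball n) (x *m Q) = dot_integral (pre_ball n) x.
Proof.
move=> QQ.
have QTQ : Q^T *m Q = 1%:M by apply: mulmx1C.
have uQ : Q^T \in unitmx by case/mulmx1_unit: QTQ.
have dQ : `|\det Q^T| = 1.
  have : `|\det Q^T| ^+ 2 = 1.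
    rewrite expr2 -{2}det_tr trmxK -normrM -det_mulmx QTQ det1 normr1 //.
  by move=> /eqP; rewrite sqrp_eq1// => /eqP.
pose phi (p : ms_car (lebesgue_space R n)) := row_inv (row_of p *m Q^T).
have mphi : measurable_fun setT phi.
  apply: measurable_row_inv => i; under eq_fun do rewrite mxE.
  apply: measurable_sum => j; apply: measurable_funM => //; exact: measurable_coord.
have f0 : {in pre_ball n, forall p, (0 <= `|dot (row_of p) x|%:E)%E}.
  by move=> p _; rewrite lee_fin.
have := @ge0_integral_pushforward _ _ _ _ R phi mphi (mu n) (pre_ball n)
  (fun p => `|dot (row_of p) x|%:E) (@measurable_pre_ball n)
  (@measurable_abs_dot n x (pre_ball n)) f0.
have -> : phi @^-1` pre_ball n = pre_ball n.
  apply/seteqP; split=> p; rewrite /phi /= row_invK unit_ballE /=;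
    by rewrite dot_mulmx trmxK -mulmxA QTQ mulmx1.
rewrite /dot_integral => E.
transitivity (\int[mu n]_(p in pre_ball n) ((fun p => `|dot (row_of p) x|%:E) \o phi) p)%E.
  by apply: eq_integral => p _; rewrite /phi /= row_invK dot_mulmx.
rewrite -E; apply: eq_measure_integral => A mA _.
have := @vol_linear R n Q^T uQ (@row_inv R n @^-1` A).
have EA : @row_of R n @^-1` (@row_inv R n @^-1` A) = A.
  by apply/seteqP; split=> p /=; rewrite row_ofK.
by rewrite /borel /vol EA dQ mul1e => /(_ mA).
Qed.

Lemma dot_integralZ n a x :
  dot_integral (pre_ball n) (a *: x) = (`|a|%:E * dot_integral (pre_ball n) x)%E.
Proof.
rewrite /dot_integral -ge0_integralZl//.
- by apply: eq_integral => p _; rewrite dotZr normrM.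
- exact: measurable_pre_ball.
- exact: measurable_abs_dot.
Qed.

Lemma dot_integral_fin n x : dot_integral (pre_ball n) x \is a fin_num.
Proof.
rewrite ge0_fin_numE; last by apply: integral_ge0 => p _; rewrite lee_fin.
apply: (@le_lt_trans _ _ (\int[mu n]_(p in pre_ball n) (norm2 x)%:E)%E).
  apply: ge0_le_integral; first exact: measurable_pre_ball.
  - by move=> p _; rewrite lee_fin.
  - exact: measurable_abs_dot.
  - exact: measurable_cst.
  - move=> p pB; rewrite lee_fin; apply: le_trans (cauchy_schwarz _ _) _.
    by rewrite ler_piMl ?norm2_ge0.
rewrite integral_cst; last exact: measurable_pre_ball.
rewrite -[X in (_ * X)%E]/(vol (unit_ball R n)) volRE; first by rewrite -EFinM ltry.
by case: (body_unit_ball R n).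
Qed.

(** The integral is invariant under rotations and absolutely homogeneous, hence
determined by its value at one unit vector. *)
Lemma dot_integralE n : exists c : R, forall x : 'rV[R]_n.+1,
   dot_integral (pre_ball n.+1) x = (c * norm2 x)%:E.
Proof.
pose e : 'rV[R]_n.+1 := delta_mx 0 0.
have e1 : dot e e = 1.
  rewrite /dot (bigD1 0)//= big1 ?addr0 => [|i i0]; rewrite !mxE ?eqxx ?mulr1//.
  by rewrite (negbTE i0) andbF mulr0.
exists (fine (dot_integral (pre_ball n.+1) e)) => x.
have [Q QQ xQ] : exists2 Q : 'M[R]_n.+1, Q *m Q^T = 1%:M & (norm2 x *: e) *m Q = x.
  by apply: householder; rewrite dotZl dotZr e1 mulr1 -expr2 sqr_norm2.
rewrite -{1}xQ dot_integral_rot// dot_integralZ.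
rewrite -{1}(fineK (dot_integral_fin e)) -EFinM; congr EFin; rewrite mulrC; congr (_ * _).
by rewrite ger0_norm ?norm2_ge0.
Qed.

(** Summed over the basis vectors the integrals bound the integral of |u|, which
is at least 1/2 on the annulus between D / 2 and D. *)
Lemma dot_integral_gt0 n (c : R) : 0 < volR (unit_ball R n.+1) ->
  (forall x : 'rV[R]_n.+1, dot_integral (pre_ball n.+1) x = (c * norm2 x)%:E) -> 0 < c.
Proof.
move=> vB Ec.
pose e i : 'rV[R]_n.+1 := delta_mx 0 i.
have dote x i : dot x (e i) = x 0 i.
  rewrite /dot (bigD1 i)//= big1 ?addr0 => [|j ji]; rewrite !mxE ?eqxx ?mulr1//.
  by rewrite (negbTE ji) andbF mulr0.
have e1 i : norm2 (e i) = 1 by rewrite norm2E dote !mxE !eqxx sqrtr1.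
have [_ cB vxB] := body_unit_ball R n.+1.
have cB2 : compact (dilate 2^-1 (unit_ball R n.+1)) by exact: compact_dilate.
have h0 : 0 < 2^-1 :> R by rewrite invr_gt0.
have sB2 : dilate 2^-1 (unit_ball R n.+1) `<=` unit_ball R n.+1.
  move=> x /(dilate_ballP _ h0) x2; rewrite /unit_ball /= (le_trans x2)//; lra.
pose half := @row_of R n.+1 @^-1` dilate 2^-1 (unit_ball R n.+1).
have mhalf : measurable half := borel_compact cB2.
pose annulus := pre_ball n.+1 `\` half.
have mannulus : measurable annulus by apply: measurableD => //; exact: measurable_pre_ball.
have Vannulus : (mu n.+1 annulus =
    (volR (unit_ball R n.+1) - volR (dilate 2^-1 (unit_ball R n.+1)))%:E)%E.
  have E : (vol (unit_ball R n.+1) =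
      mu n.+1 annulus + vol (dilate 2^-1 (unit_ball R n.+1)))%E.
    rewrite /vol -measureU//; last by rewrite setDKI.
    by congr (mu n.+1 _); rewrite setUC setDUK // => p; exact: sB2.
  move: E; rewrite !volRE// => E; rewrite EFinB E addeK//.
have annulus_gt0 : 0 < volR (unit_ball R n.+1) - volR (dilate 2^-1 (unit_ball R n.+1)).
  rewrite volR_dilate// -[X in X - _]mul1r -mulrBl mulr_gt0// subr_gt0.
  by rewrite exprn_ilt1// ?ltW//; lra.
have : (2^-1%:E * mu n.+1 annulus <= \sum_(i < n.+1) dot_integral (pre_ball n.+1) (e i))%E.
  rewrite /dot_integral -ge0_integral_sum; [|exact: measurable_pre_ball
    |by move=> i; exact: measurable_abs_dot|by move=> i p _; rewrite lee_fin].
  rewrite -integral_cst//.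
  apply: (@le_trans _ _ (\int[mu n.+1]_(p in annulus)
      \sum_(i < n.+1) `|dot (row_of p) (e i)|%:E)%E).
    apply: ge0_le_integral => //.
    - by move=> p _; rewrite lee_fin.
    - apply: emeasurable_sum => i; exact: measurable_abs_dot.
    - move=> p [pB /= ph]; rewrite sumEFin lee_fin.
      under eq_bigr do rewrite dote.
      apply: le_trans (norm2_le_sum _); rewrite leNgt; apply/negP => hh; apply: ph.
      by apply/dilate_ballP => //; exact: ltW.
  apply: ge0_subset_integral => //.
  - exact: measurable_pre_ball.
  - apply: emeasurable_sum => i; exact: measurable_abs_dot.
  - by move=> p _; apply: sume_ge0 => i _; rewrite lee_fin.
  - exact: subDsetl.
under eq_bigr do rewrite Ec e1 mulr1.
rewrite Vannulus sumEFin -EFinM lee_fin sumr_const card_ord => H.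
have : 0 < c *+ n.+1 by apply: lt_le_trans H; rewrite mulr_gt0.
by rewrite pmulrn_lgt0.
Qed.

(** On a piece within distance ep of its center c the function <u, x> differs from
<c, x> by at most ep |x|; the generator attached to the piece
is c times its measure.  The pieces are cut off one center after the other. *)
Lemma dot_integral_approx n (ep : R) (cs : seq 'rV[R]_n) A : 0 < ep -> measurable A ->
  A `<=` pre_ball n ->
  (forall p, A p -> exists2 c, c \in cs & norm2 (row_of p - c) <= ep) ->
  exists vs, forall x,
    (dot_integral A x <= (zonotope_support vs x)%:E + (ep * norm2 x)%:E * mu n A)%E /\
    ((zonotope_support vs x)%:E <= dot_integral A x + (ep * norm2 x)%:E * mu n A)%E.
Proof.
move=> ep0; elim: cs A => [|c cs IH] A mA AB cov.
  have -> : A = set0 by apply/seteqP; split=> // p /cov[].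
  exists [::] => x; rewrite /zonotope_support big_nil measure0 mule0 adde0.
  by rewrite /dot_integral integral_set0 adde0.
pose near_c := [set p | norm2 (@row_of R n p - c) <= ep].
have mnear : measurable near_c.
  have -> : near_c = @row_of R n @^-1` ((+%R^~ (- c)) @^-1` dilate ep (unit_ball R n)).
    by apply/seteqP; split=> p /= /(dilate_ballP _ ep0).
  apply: borel_shift; apply: borel_compact; apply: compact_dilate.
  by case: (body_unit_ball R n).
pose A1 := A `&` near_c; pose A2 := A `\` near_c.
have mA1 : measurable A1 by exact: measurableI.
have mA2 : measurable A2 by exact: measurableD.
have EA : A = A1 `|` A2 by rewrite setUIDK.
have I0 : A1 `&` A2 = set0 by apply/seteqP; split=> p //= [[_ h1] [_ h2]].
have dA : [disjoint A1 & A2] by apply/disj_set2P.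
have [|p [Ap np]|vs Hvs] := IH A2 mA2.
- by move=> p [Ap _]; exact: AB.
- have [c' + c'p] := cov p Ap; rewrite in_cons => /predU1P[c'c|c'cs]; last by exists c'.
  by exfalso; apply: np; rewrite /near_c /= -c'c.
have finA1 : mu n A1 \is a fin_num.
  rewrite ge0_fin_numE//; apply: (@le_lt_trans _ _ (vol (unit_ball R n))).
    apply: le_measure; rewrite ?inE//; first exact: measurable_pre_ball.
    by move=> p [Ap _]; exact: AB.
  by rewrite volRE ?ltry//; case: (body_unit_ball R n).
exists ((fine (mu n A1) *: c) :: vs) => x.
have [H1 H2] := Hvs x.
have mEA : mu n A = (mu n A1 + mu n A2)%E.
  by rewrite {1}EA measureU.
have iEA : dot_integral A x = (dot_integral A1 x + dot_integral A2 x)%E.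
  rewrite /dot_integral {1}EA ge0_integral_setU//.
  exact: measurable_abs_dot.
have sE : (zonotope_support ((fine (mu n A1) *: c) :: vs) x)%:E =
    (`|dot c x|%:E * mu n A1 + (zonotope_support vs x)%:E)%E.
  rewrite /zonotope_support big_cons dotZl normrM ger0_norm ?fine_ge0//.
  by rewrite EFinD EFinM fineK// muleC.
have dist p : A1 p -> `|dot (row_of p) x - dot c x| <= ep * norm2 x.
  move=> [_ pc]; rewrite -dotBl; apply: le_trans (cauchy_schwarz _ _) _.
  by rewrite ler_wpM2r ?norm2_ge0.
have K1 : (dot_integral A1 x <= `|dot c x|%:E * mu n A1 + (ep * norm2 x)%:E * mu n A1)%E.
  rewrite -ge0_muleDl ?lee_fin ?mulr_ge0 ?norm2_ge0 ?(ltW ep0)// -EFinD -integral_cst//.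
  apply: ge0_le_integral => //.
  - exact: measurable_abs_dot.
  - move=> p /dist d; rewrite lee_fin.
    have := ler_normD (dot c x) (dot (row_of p) x - dot c x); rewrite subrKC; lra.
have K2 : (`|dot c x|%:E * mu n A1 <= dot_integral A1 x + (ep * norm2 x)%:E * mu n A1)%E.
  rewrite -!integral_cst// /dot_integral -ge0_integralD//; [|exact: measurable_abs_dot|
    by move=> p _; rewrite lee_fin mulr_ge0 ?norm2_ge0 ?ltW].
  apply: ge0_le_integral => //.
  - by move=> p _; rewrite lee_fin.
  - by apply: emeasurable_funD => //; exact: measurable_abs_dot.
  - move=> p /dist d; rewrite lee_fin.
    have := ler_normD (dot (row_of p) x) (dot c x - dot (row_of p) x).
    by rewrite subrKC [`|dot c x - _|]distrC; lra.
rewrite sE iEA mEA ge0_muleDr//; split.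
  rewrite [leRHS]addeACA; exact: leeD K1 H1.
rewrite [leRHS]addeACA; exact: leeD K2 H2.
Qed.

Lemma ball_cover n (ep : R) : 0 < ep -> exists cs : seq 'rV[R]_n,
  forall x, unit_ball R n x -> exists2 c, c \in cs & norm2 (x - c) <= ep.
Proof.
move=> ep0; have [_ cB _] := body_unit_ball R n.
pose d := ep / n.+1%:R.
have d0 : 0 < d by rewrite divr_gt0.
move: cB; rewrite compact_cover => /(_ _ setT (fun c : 'rV[R]_n => ball c d)).
case=> [c _|x _|D _ BD].
- exact: ball_open.
- by exists x => //; exact: ballxx.
exists (finmap.enum_fset D) => x /BD [c /= cD [_ /= H]]; exists c => //.
apply: (@le_trans _ _ (n%:R * d)).
  apply: norm2_le_sup => i; have := H 0 i; rewrite /ball /= !mxE distrC => /ltW.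
  exact.
by rewrite /d mulrCA ler_piMr ?(ltW ep0)// ler_pdivrMr// mul1r ler_nat.
Qed.

Theorem ball_zonotope n (ep : R) : 0 < volR (unit_ball R n.+1) -> 0 < ep -> ep < 1 ->
  exists vs, dilate (1 - ep) (unit_ball R n.+1) `<=` zonotope vs /\
             zonotope vs `<=` dilate (1 + ep) (unit_ball R n.+1).
Proof.
move=> vB ep0 ep1.
have [c Ec] := dot_integralE n.
have c0 := dot_integral_gt0 vB Ec.
pose b := volR (unit_ball R n.+1).
(* with this mesh the total error is d |x| vol(D) = ep c |x| *)
pose d := ep * c / b.
have d0 : 0 < d by rewrite divr_gt0 ?mulr_gt0.
have [cs Hcs] := ball_cover n.+1 d0.
have [|vs Hvs] := dot_integral_approx d0 (@measurable_pre_ball n.+1)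
  (@subset_refl _ _) (cs := cs).
  by move=> p /Hcs.
have {}Hvs x : c * norm2 x <= zonotope_support vs x + ep * c * norm2 x /\
    zonotope_support vs x <= c * norm2 x + ep * c * norm2 x.
  have := Hvs x; rewrite Ec -[mu _ _]/(vol (unit_ball R n.+1)).
  rewrite volRE; last by case: (body_unit_ball R n.+1).
  rewrite -EFinM -!EFinD !lee_fin -/b.
  have -> // : d * norm2 x * b = ep * c * norm2 x.
  by rewrite /d; field; exact: lt0r_neq0.
exists [seq c^-1 *: v | v <- vs].
have Es x : zonotope_support [seq c^-1 *: v | v <- vs] x = c^-1 * zonotope_support vs x.
  rewrite /zonotope_support big_map mulr_sumr; apply: eq_bigr => v _.
  by rewrite dotZl normrM gtr0_norm ?invr_gt0.
split.
  apply: ball_sub_zonotope; first by rewrite subr_gt0.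
  move=> x; rewrite Es ler_pdivlMl//; have [h _] := Hvs x; lra.
apply: zonotope_sub_ball; first by rewrite addr_gt0.
move=> x; rewrite Es ler_pdivrMl//; have [_ h] := Hvs x; lra.
Qed.

End ball_is_zonoid.

(** * Polynomials on a half-line *)
Section real_polynomials.
Context (R : realType).
Implicit Types p q : {poly R}.

Lemma horner_le_at0 p q d : 0 < d ->
  (forall s, 0 < s -> s <= d -> p.[s] <= q.[s]) -> p.[0] <= q.[0].
Proof.
move=> d0 H.
have c r : horner r x @[x --> (0 : R)^'+] --> r.[0].
  by apply: cvg_at_right_filter; exact: continuous_horner.
apply: (ler_cvg_to (c p) (c q)); near=> s; apply: H; near: s.
  exact: nbhs_right_gt.
by near=> s; apply: ltW; near: s; apply: nbhs_right_lt.
Unshelve. all: by end_near. Qed.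

(** Substituting 1/s moves the behaviour of p at infinity to 0. *)
Definition rev_poly d p : {poly R} := \poly_(i < d.+1) p`_(d - i).

Lemma horner_rev_poly d p s : (size p <= d.+1)%N -> s != 0 ->
  (rev_poly d p).[s] = s ^+ d * p.[s^-1].
Proof.
move=> sp s0; rewrite horner_poly (horner_coef_wide _ sp) mulr_sumr.
rewrite (reindex_inj rev_ord_inj) /=; apply: eq_bigr => i _.
rewrite subSS subKn -1?ltnS// mulrCA; congr (_ * _).
by rewrite exprVn exprB// -1?ltnS// unitfE.
Qed.

Lemma rev_poly0 d p : (rev_poly d p).[0] = p`_d.
Proof. by rewrite horner_coef0 coef_poly subn0. Qed.

(** If p had degree d > m, then s^d p(1/s) would lie between 0 and a multiple of
s^(d-m) for small s > 0, so that its value at 0, the leading coefficient of p,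
would vanish. *)
Lemma size_poly_growth m p (C r : R) : 0 <= C ->
  (forall t, 0 <= t -> 0 <= p.[t] <= C * (r + t) ^+ m) -> (size p <= m.+1)%N.
Proof.
move=> C0 H; rewrite leqNgt; apply/negP => mp.
pose d := (size p).-1.
have md : (m < d)%N by rewrite /d; case: (size p) mp.
have sd : (size p <= d.+1)%N by exact: leqSpred.
have Hs s : 0 < s -> s <= 1 ->
    0 <= (rev_poly d p).[s] <= ('X ^+ (d - m) * (C%:P * (r *: 'X + 1%:P) ^+ m)).[s].
  move=> s0 s1; rewrite horner_rev_poly ?gt_eqF//.
  have /andP[h1 h2] := H s^-1 ltac:(by rewrite invr_ge0 ltW).
  rewrite mulr_ge0 ?exprn_ge0 ?(ltW s0)//=.
  apply: le_trans (ler_wpM2l _ h2) _; first by rewrite exprn_ge0 ?(ltW s0).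
  rewrite hornerM hornerXn hornerM hornerC horner_exp hornerD hornerZ hornerX hornerC.
  rewrite -{1}(subnK (ltnW md)) exprD -mulrA ler_wpM2l ?exprn_ge0 ?(ltW s0)//.
  rewrite mulrCA ler_wpM2l// -exprMn.
  by have -> // : s * (r + s^-1) = r * s + 1; field; rewrite gt_eqF.
have h1 : (rev_poly d p).[0] <= 0.
  pose q : {poly R} := 'X ^+ (d - m) * (C%:P * (r *: 'X + 1%:P) ^+ m).
  apply: (le_trans (horner_le_at0 (q := q) ltr01 _)).
    by move=> s s0 s1; case/andP: (Hs s s0 s1).
  by rewrite /q hornerM hornerXn expr0n subn_eq0 leqNgt md mul0r.
have h2 : 0 <= (rev_poly d p).[0].
  rewrite -[leLHS](horner0 0); apply: (horner_le_at0 ltr01) => s s0 s1.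
  by rewrite horner0; case/andP: (Hs s s0 s1).
have : (rev_poly d p).[0] = 0 by apply/eqP; rewrite eq_le h1.
rewrite rev_poly0 => /eqP; rewrite -lead_coefE lead_coef_eq0 => /eqP p0.
by move: mp; rewrite p0 size_poly0.
Qed.

(** The candidate q interpolates f at N points.  An approximation p of f of the same
size equals its own interpolation, so |f - q| is at most eta times a quantity M
that does not depend on eta. *)
Lemma poly_approx N (f : R -> R) : (0 < N)%N -> (forall t, 0 <= t -> 0 <= f t) ->
  (forall eta, 0 < eta -> exists2 p : {poly R}, (size p <= N)%N &
     forall t, 0 <= t -> `|p.[t] - f t| <= eta * f t) ->
  exists2 p : {poly R}, (size p <= N)%N & forall t, 0 <= t -> f t = p.[t].
Proof.
move=> N0 f0 H.
pose x (i : nat) : R := i%:R.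
have x_inj : injective x by move=> i j /eqP; rewrite eqr_nat => /eqP.
pose L (i : 'I_N) : {poly R} := tnth (lagrange N x) i.
pose q := \sum_(i < N) (f (x i))%:P * L i.
exists q.
  apply: (leq_trans (size_sum _ _ _)); apply/bigmax_leqP => i _.
  by rewrite mul_polyC (leq_trans (size_scale_leq _ _))// size_lagrange_.
move=> t t0; pose M := f t + \sum_(i < N) f (x i) * `|(L i).[t]|.
have M0 : 0 <= M.
  by rewrite addr_ge0 ?f0// sumr_ge0// => i _; rewrite mulr_ge0 ?f0// ler0n.
suff K eta : 0 < eta -> `|f t - q.[t]| <= eta * M.
  apply/eqP; rewrite -subr_eq0 -normr_le0 leNgt; apply/negP => h.
  have M1 : 0 < M + 1 by rewrite ltr_wpDl.
  have := K (`|f t - q.[t]| / (M + 1)) ltac:(by rewrite divr_gt0).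
  by rewrite mulrAC ler_pdivlMr// ler_pM2l//; lra.
move=> eta0; have [p sp Hp] := H eta eta0.
have -> : f t - q.[t] = (f t - p.[t]) + \sum_(i < N) (p.[x i] - f (x i)) * (L i).[t].
  rewrite {1}(lagrange_gen N0 x_inj sp) /q !horner_sum.
  rewrite -[LHS]addr0 -addrA -[RHS]addrA; congr (_ + _).
  rewrite addr0 -sumrN -sumrN -big_split /=; apply: eq_bigr => i _.
  rewrite !hornerM !hornerC; ring.
apply: (le_trans (ler_normD _ _)); rewrite /M mulrDr lerD//.
  by rewrite distrC Hp.
apply: (le_trans (ler_norm_sum _ _ _)); rewrite mulr_sumr ler_sum// => i _.
by rewrite normrM mulrA ler_wpM2r// Hp// ler0n.
Qed.

Lemma expr_close n (eta : R) : 0 < eta -> exists ep : R, [/\ 0 < ep, ep < 1,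
  (1 + ep) ^+ n <= 1 + eta & 1 - eta <= (1 - ep) ^+ n].
Proof.
move=> eta0.
have up m (e : R) : 0 <= e -> e <= 1 -> (1 + e) ^+ m <= 1 + (2 ^+ m - 1) * e.
  move=> e0 e1; elim: m => [|m IH]; first by rewrite !expr0; lra.
  rewrite exprSr; apply: le_trans (ler_wpM2r _ IH) _; first by lra.
  have h : 1 <= 2 ^+ m :> R by rewrite exprn_ege1// ler1n.
  have h2 : (2 ^+ m - 1) * e * e <= (2 ^+ m - 1) * e by rewrite ler_piMr// mulr_ge0//; lra.
  by rewrite exprS; lra.
have dn m (e : R) : 0 <= e -> e <= 1 -> 1 - m%:R * e <= (1 - e) ^+ m.
  move=> e0 e1; elim: m => [|m IH]; first by rewrite !expr0; lra.
  rewrite exprSr; apply: le_trans (ler_wpM2r _ IH); last by lra.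
  rewrite -natr1; have : 0 <= m%:R * e * e by rewrite !mulr_ge0// ler0n.
  lra.
pose M : R := 2 ^+ n + n%:R + 1.
have h : 1 <= 2 ^+ n :> R by rewrite exprn_ege1// ler1n.
have h' : 0 <= n%:R :> R by [].
have M0 : 0 < M by rewrite /M; lra.
have M2 : M * (eta / (M * (1 + eta))) = eta / (1 + eta) by field; rewrite !gt_eqF//; lra.
have e0 : 0 < eta / (M * (1 + eta)) by rewrite divr_gt0// mulr_gt0//; lra.
set e := eta / _ in M2 e0.
have e2 : M * e <= eta by rewrite M2 ler_pdivrMr; [|lra]; rewrite ler_peMr; lra.
have e3 : M * e < 1 by rewrite M2 ltr_pdivrMr; lra.
have e4 : 2 ^+ n * e + n%:R * e + e = M * e by rewrite /M; ring.
have e5 : e <= 2 ^+ n * e by rewrite ler_peMl// ltW.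
have e6 : 0 <= n%:R * e by rewrite mulr_ge0// ltW.
exists e; split => //; first by lra.
  by apply: le_trans (up n e _ _) _; lra.
by apply: le_trans (dn n e _ _); lra.
Qed.

End real_polynomials.

(** * Steiner formula *)
Section steiner.
Context (R : realType) (n : nat).
Notation ball := (unit_ball R n).

(** Adding the generator v to Z adds to K + t Z the segment [0, t (2 v)], up to a
translation.  With p_L(t) = vol(L + t Z), [volR_segment] turns the new volume into
p_K(t) + t (p_(K + [0, 2v])(t) - p_K(t)): the induction is on all K at once. *)
Lemma volR_sum_zonotope (K : set 'rV[R]_n) vs : body K ->
  exists p : {poly R}, forall t, 0 <= t ->
    volR (msum K (dilate t (zonotope vs))) = p.[t].
Proof.
elim: vs K => [|v vs IH] K bK /=.
  exists (volR K)%:P => t t0; rewrite hornerC.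
  by rewrite dilate_set0 msum0.
have bS := @body_segment R n 1 (2 *: v) ler01.
have [p1 H1] := IH K bK.
have [p2 H2] := IH (msum K (segment 1 (2 *: v))) (body_msum bK bS).
exists (p1 + 'X * (p2 - p1)) => t t0.
have bL : body (msum K (dilate t (zonotope vs))).
  by apply: body_msum => //; apply: body_dilate; exact: body_zonotope.
have bT := body_msum bL (body_segment (2 *: v) t0).
rewrite dilate_msum msumA dilate_sym_segment// msumA volR_shift; last by case: bT.
rewrite (volR_segment _ t0 bL) -msumA [msum (dilate t _) _]msumC msumA H1// H2//.
by rewrite !hornerE.
Qed.

Lemma volR_point m : volR ([set 0] : set 'rV[R]_m.+1) = 0.
Proof.
have := volR_dilate (@compact_set1 _ (0 : 'rV[R]_m.+1)) (ltr0Sn R 1).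
rewrite dilate_set0.
have : 1 < 2 ^+ m.+1 :> R by rewrite exprn_egt1// ltr1n.
move=> h E; have : (2 ^+ m.+1 - 1) * volR ([set 0] : set 'rV[R]_m.+1) = 0 by lra.
by move/eqP; rewrite mulf_eq0 gt_eqF ?subr_gt0// => /eqP.
Qed.

Lemma sub_dilate_ball (K : set 'rV[R]_n) : compact K ->
  exists2 r, 0 < r & K `<=` dilate r ball.
Proof.
move=> cK; have [M [_ HM]] := compact_bounded cK.
have M1 : M < `|M| + 1 by rewrite (le_lt_trans (ler_norm M))// ltrDl.
have r0 : 0 < n.+1%:R * (`|M| + 1) by rewrite mulr_gt0// ltr_wpDl.
exists (n.+1%:R * (`|M| + 1)) => // x Kx; apply/dilate_ballP => //.
apply: (@le_trans _ _ (n%:R * (`|M| + 1))); last first.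
  by rewrite ler_wpM2r ?addr_ge0// ler_nat.
apply: norm2_le_sup => i; apply: le_trans (coord_le_norm _ _) _.
exact: HM Kx.
Qed.

End steiner.

Section steiner_formula.
Context (R : realType) (n : nat).
Notation ball := (unit_ball R n.+1).
Hypothesis vB : 0 < volR ball.

Let bB := body_unit_ball R n.+1.

(** Since 0 is in K, (1 - e) (K + t D) is contained in K + t Z and K + t Z in
(1 + e) (K + t D), so the volumes differ by a factor close to 1. *)
Lemma parallel_volume_poly (K : set 'rV[R]_n.+1) : body K -> K 0 ->
  exists2 p : {poly R}, (size p <= n.+2)%N &
    forall t, 0 <= t -> volR (msum K (dilate t ball)) = p.[t].
Proof.
move=> bK K0; have [_ cK vK] := bK; have [_ cB vxB] := bB.
have B0 : ball 0 by rewrite /unit_ball /= norm20.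
have cKB t : compact (msum K (dilate t ball)).
  by apply: compact_msum => //; exact: compact_dilate.
apply: poly_approx => // [t _|eta eta0]; first exact: volR_ge0.
have [e [e0 e1 he1 he2]] := expr_close n.+1 eta0.
have [vs [lo up]] := ball_zonotope vB e0 e1.
have [p Hp] := volR_sum_zonotope vs bK.
have cKZ t : compact (msum K (dilate t (zonotope vs))).
  by apply: compact_msum => //; apply: compact_dilate; case: (body_zonotope vs).
have [r r0 Kr] := sub_dilate_ball cK.
have upper t : 0 <= t -> p.[t] <= (1 + e) ^+ n.+1 * volR (msum K (dilate t ball)).
  move=> t0; rewrite -Hp// -volR_dilate//; last by rewrite addr_gt0.
  apply: le_volR => //; first exact: compact_dilate.
  rewrite dilate_msum; apply: msumS.
    rewrite -[X in X `<=` _]dilate1; apply: dilate_le => //; lra.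
  by rewrite dilateM mulrC -dilateM; exact: dilateS.
have lower t : 0 <= t -> (1 - e) ^+ n.+1 * volR (msum K (dilate t ball)) <= p.[t].
  move=> t0; rewrite -Hp// -volR_dilate//; last by rewrite subr_gt0.
  apply: le_volR => //; first exact: compact_dilate.
  rewrite dilate_msum; apply: msumS.
    rewrite -[X in _ `<=` X]dilate1; apply: dilate_le => //; lra.
  by rewrite dilateM mulrC -dilateM; exact: dilateS.
have growth t : 0 <= t -> volR (msum K (dilate t ball)) <= (r + t) ^+ n.+1 * volR ball.
  move=> t0; rewrite -volR_dilate//; last by rewrite ltr_wpDr.
  apply: le_volR => //; first exact: compact_dilate.
  by rewrite dilateD ?(ltW r0)//; exact: msumS.
exists p.
  apply: (@size_poly_growth R n.+1 p ((1 + e) ^+ n.+1 * volR ball) r).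
    by rewrite mulr_ge0 ?volR_ge0// exprn_ge0//; lra.
  move=> t t0; rewrite -{1}Hp// volR_ge0/=; apply: (le_trans (upper t t0)).
  rewrite -mulrA ler_wpM2l ?exprn_ge0//; first by lra.
  by rewrite mulrC growth.
move=> t t0; have V0 := volR_ge0 (msum K (dilate t ball)).
rewrite ler_norml; apply/andP; split.
  have := lower t t0; have := ler_wpM2r V0 he2; lra.
have := upper t t0; have := ler_wpM2r V0 he1; lra.
Qed.

(** For s > 0 this is homogeneity.  At s = 0 one must know that the coefficient of
t^(n+1) is the volume of the ball: it is the limit as s tends to 0 of
vol(s K + D), which lies between vol(D) and (r s + 1)^(n+1) vol(D) when K is
contained in r D. *)
Lemma steiner0 (K : set 'rV[R]_n.+1) : body K -> K 0 ->
  exists c : nat -> R, forall s t, 0 <= s -> 0 <= t ->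
    volR (msum (dilate s K) (dilate t ball)) =
      \sum_(k < n.+2) c k * s ^+ k * t ^+ (n.+1 - k).
Proof.
move=> bK K0; have [p sp Hp] := parallel_volume_poly bK K0.
have [_ cK vK] := bK; have [_ cB vxB] := bB.
have [r r0 Kr] := sub_dilate_ball cK.
have B0 : ball 0 by rewrite /unit_ball /= norm20.
pose c k := p`_(n.+1 - k).
have Hpos s t : 0 < s -> 0 <= t ->
    volR (msum (dilate s K) (dilate t ball)) = s ^+ n.+1 * p.[t / s].
  move=> s0 t0; rewrite -Hp ?divr_ge0 ?(ltW s0)//.
  rewrite -volR_dilate//; last by apply: compact_msum => //; exact: compact_dilate.
  by rewrite dilate_msum dilateM mulrC divfK// gt_eqF.
have cn s t : 0 <= s -> 0 <= t -> compact (msum (dilate s K) (dilate t ball)).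
  by move=> s0 t0; apply: compact_msum; exact: compact_dilate.
have top : p`_n.+1 = volR ball.
  rewrite -rev_poly0; apply/eqP; rewrite eq_le; apply/andP; split.
    have -> : volR ball = ((r *: 'X + 1%:P) ^+ n.+1 * (volR ball)%:P).[0].
      by rewrite hornerM horner_exp hornerD hornerZ hornerX !hornerC mulr0 add0r expr1n mul1r.
    apply: (horner_le_at0 ltr01) => s s0 s1.
    rewrite horner_rev_poly ?gt_eqF// -[s^-1]mul1r -Hpos//.
    rewrite hornerM horner_exp hornerD hornerZ hornerX !hornerC.
    rewrite -volR_dilate//; last by rewrite ltr_wpDl ?mulr_ge0 ?(ltW r0) ?(ltW s0).
    apply: le_volR; [exact: cn (ltW s0) ler01|exact: compact_dilate|].
    rewrite dilateD ?mulr_ge0 ?(ltW s0) ?(ltW r0)//; apply: msumS => //.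
    by rewrite mulrC -dilateM; exact: dilateS.
  rewrite -[leLHS](hornerC _ 0); apply: (horner_le_at0 ltr01) => s s0 s1.
  rewrite horner_rev_poly ?gt_eqF// -[s^-1]mul1r -Hpos// hornerC.
  apply: le_volR; [exact: cB|exact: cn (ltW s0) ler01|].
  rewrite dilate1 => x Bx; exists 0; first by exists 0; rewrite ?scaler0.
  by exists x; rewrite ?add0r.
exists c => s t s0 t0; have [->|sn0] := eqVneq s 0.
  rewrite dilate0; last by exists 0.
  rewrite msumC msum0 big_ord_recl /= big1 => [|i _]; last first.
    by rewrite /bump expr0n mulr0 mul0r.
  rewrite expr0 mulr1 addr0 subn0 /c subn0 top.
  have [->|tn0] := eqVneq t 0.
    rewrite dilate0; last by exists 0.
    by rewrite volR_point expr0n mulr0.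
  rewrite volR_dilate//; first by rewrite mulrC.
  by rewrite lt_neqAle eq_sym tn0.
have sp0 : 0 < s by rewrite lt_neqAle eq_sym sn0.
rewrite Hpos// (horner_coef_wide _ sp) mulr_sumr (reindex_inj rev_ord_inj) /=.
apply: eq_bigr => i _; rewrite subSS /c expr_div_n.
have le : (i <= n.+1)%N by rewrite -ltnS.
rewrite -[X in s ^+ X](subnK le) exprD.
field.
by rewrite expf_neq0.
Qed.

End steiner_formula.

(** * Mixed volumes as coefficients *)
Section mixed_volumes.
Context (R : realType).

Lemma msum_point n (A : set 'rV[R]_n) x : msum (msum A [set - x]) [set x] = A.
Proof.
rewrite -msumA; have -> : msum [set - x] [set x] = [set 0] :> set 'rV[R]_n.
  apply/seteqP; split=> [_ [_ -> [_ -> <-]]|_ ->] /=; first by rewrite addNr.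
  by exists (- x) => //; exists x; rewrite ?addNr.
by rewrite msum0.
Qed.

Lemma steiner n (K : set 'rV[R]_n.+1) : 0 < volR (unit_ball R n.+1) -> body K ->
  exists c : nat -> R, forall s t, 0 <= s -> 0 <= t ->
    volR (msum (dilate s K) (dilate t (unit_ball R n.+1))) =
      \sum_(k < n.+2) c k * s ^+ k * t ^+ (n.+1 - k).
Proof.
move=> vB bK; have [[x Kx] cK vK] := bK.
have b1 : body [set - x] by exact: body_set1.
have [|c Hc] := steiner0 vB (body_msum bK b1).
  by exists x => //; exists (- x); rewrite ?subrr.
exists c => s t s0 t0; rewrite -Hc//.
have cL : compact (msum (dilate s (msum K [set - x])) (dilate t (unit_ball R n.+1))).
  apply: compact_msum; apply: compact_dilate; last by case: (body_unit_ball R n.+1).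
  by case: (body_msum bK b1).
rewrite -(volR_shift (s *: x) cL); congr volR.
rewrite -msumA [msum (dilate t _) _]msumC msumA; congr (msum _ _).
have -> : [set s *: x] = dilate s [set x].
  by apply/seteqP; split=> [_ ->|_ [_ -> <-]] //; exists x.
by rewrite -dilate_msum msum_point.
Qed.

Lemma dilate_big n (A : set 'rV[R]_n) (I : Type) (r : seq I) (P : pred I)
    (w : I -> R) (x : I -> 'rV[R]_n) :
  body A -> (forall i, 0 <= w i) -> (forall i, P i -> A (x i)) ->
  dilate (\sum_(i <- r | P i) w i) A (\sum_(i <- r | P i) w i *: x i).
Proof.
move=> [[a Aa] _ vA] w0 Ax.
suff [] : 0 <= \sum_(i <- r | P i) w i /\
  dilate (\sum_(i <- r | P i) w i) A (\sum_(i <- r | P i) w i *: x i) by [].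
elim/big_rec2: _ => [|i y s Pi [s0 Hs]].
  by split=> //; exists a; rewrite ?scale0r.
split; first by rewrite addr_ge0.
rewrite dilateD//; exists (w i *: x i); first by exists (x i) => //; exact: Ax.
by exists y.
Qed.

Lemma minkowski_comb_two n m j (K B : set 'rV[R]_n) (lambda : 'rV[R]_m) :
  body K -> body B -> (forall i, 0 <= lambda 0 i) ->
  minkowski_comb (fun i : 'I_m => if (i < j)%N then K else B) lambda =
  msum (dilate (\sum_(i < m | (i < j)%N) lambda 0 i) K)
       (dilate (\sum_(i < m | ~~ (i < j)%N) lambda 0 i) B).
Proof.
move=> bK bB l0; apply/seteqP; split.
  move=> _ [x Hx <-].
  have -> : \sum_(i < m) lambda 0 i *: x i = \sum_(i < m | (i < j)%N) lambda 0 i *: x i +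
      \sum_(i < m | ~~ (i < j)%N) lambda 0 i *: x i.
    by rewrite (bigID (fun i : 'I_m => (i < j)%N)).
  exists (\sum_(i < m | (i < j)%N) lambda 0 i *: x i).
    apply: (@dilate_big n K 'I_m _ _ (fun i => lambda 0 i) x) => // i ij.
    by have := Hx i; rewrite ij.
  exists (\sum_(i < m | ~~ (i < j)%N) lambda 0 i *: x i) => //.
  apply: (@dilate_big n B 'I_m _ _ (fun i => lambda 0 i) x) => // i /negbTE ij.
  by have := Hx i; rewrite ij.
move=> _ [_ [a Ka <-] [_ [b Bb <-] <-]].
exists (fun i : 'I_m => if (i < j)%N then a else b).
  by move=> i /=; case: ifP.
rewrite [LHS](bigID (fun i : 'I_m => (i < j)%N)) /= !scaler_suml; congr (_ + _).
  by apply: eq_bigr => i ->.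
by apply: eq_bigr => i /negbTE ->.
Qed.

Lemma right_derivative_poly (p : {poly R}) x :
  h^-1 * (p.[x + h] - p.[x]) @[h --> 0^'+] --> p^`().[x].
Proof.
have [D E] := is_derive_poly p x.
move: D; rewrite /derivable => /cvg_ex[l Dl].
have lE : l = p^`().[x] by rewrite -E; apply/esym/cvg_lim.
rewrite -lE; apply: cvg_trans (cvg_dnbhs_at_right Dl).
apply: near_eq_cvg; near=> h.
by rewrite /= [h%:A + x]addrC /GRing.scale /= mulr1.
Unshelve. all: by end_near. Qed.

Section iterated_derivatives.
Variables (m j N : nat) (c : nat -> R).

Definition low_sum (lambda : 'rV[R]_m) : R := \sum_(i < m | (i < j)%N) lambda 0 i.
Definition high_sum (lambda : 'rV[R]_m) : R := \sum_(i < m | ~~ (i < j)%N) lambda 0 i.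

(** The form sum_k c_k S^k T^(N-k) in S = [low_sum] and T = [high_sum],
differentiated p times in S and q times in T. *)
Definition form_deriv (p q : nat) (lambda : 'rV[R]_m) : R :=
  \sum_(k < N.+1) c k * ((k ^_ p)%:R * low_sum lambda ^+ (k - p)) *
     (((N - k) ^_ q)%:R * high_sum lambda ^+ (N - k - q)).

Definition orthant : set 'rV[R]_m := [set lambda | forall i, 0 <= lambda 0 i].

Lemma low_sumD (lambda : 'rV[R]_m) h i :
  low_sum (lambda + h *: delta_mx 0 i) = low_sum lambda + (if (i < j)%N then h else 0).
Proof.
rewrite /low_sum; under eq_bigr do rewrite !mxE eqxx /=.
rewrite big_split /=; congr (_ + _); case: ifP => ij.
  rewrite (bigD1 i)//= eqxx mulr1 big1 ?addr0// => k /andP[_ ki].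
  by rewrite (negbTE ki) mulr0.
rewrite big1// => k kj; have [E|] := eqVneq k i; last by rewrite mulr0.
by rewrite -E kj in ij.
Qed.

Lemma high_sumD (lambda : 'rV[R]_m) h i :
  high_sum (lambda + h *: delta_mx 0 i) = high_sum lambda + (if (i < j)%N then 0 else h).
Proof.
rewrite /high_sum; under eq_bigr do rewrite !mxE eqxx /=.
rewrite big_split /=; congr (_ + _); case: ifPn => ij.
  rewrite big1// => k kj; have [E|] := eqVneq k i; last by rewrite mulr0.
  by rewrite E ij in kj.
rewrite (bigD1 i)//= eqxx mulr1 big1 ?addr0// => k /andP[_ ki].
by rewrite (negbTE ki) mulr0.
Qed.

(** Along the i-th direction only one of the sums S and T varies, with speed 1, so
the one-sided difference quotient is that of a polynomial in one variable. *)
Lemma right_partial_form G p q i :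
  (forall lambda, orthant lambda -> G lambda = form_deriv p q lambda) ->
  forall lambda, orthant lambda ->
    right_partial i G lambda = form_deriv (p + (i < j)%N) (q + ~~ (i < j)%N) lambda.
Proof.
move=> HG lambda l0.
have l0h h : 0 <= h -> orthant (lambda + h *: delta_mx 0 i).
  by move=> h0 k; rewrite !mxE eqxx /= addr_ge0// mulr_ge0// ler0n.
pose P : {poly R} := if (i < j)%N then
   \sum_(k < N.+1) (c k * (((N - k) ^_ q)%:R * high_sum lambda ^+ (N - k - q)) *
                     (k ^_ p)%:R) *: 'X^(k - p)
  else
   \sum_(k < N.+1) (c k * ((k ^_ p)%:R * low_sum lambda ^+ (k - p)) *
                     ((N - k) ^_ q)%:R) *: 'X^(N - k - q).
pose x := if (i < j)%N then low_sum lambda else high_sum lambda.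
have EP h : form_deriv p q (lambda + h *: delta_mx 0 i) = P.[x + h].
  rewrite /form_deriv low_sumD high_sumD /P /x; case: ifP => _; rewrite !addr0 horner_sum;
    by apply: eq_bigr => k _; rewrite hornerZ hornerXn; ring.
have EP0 : form_deriv p q lambda = P.[x].
  by rewrite -[lambda in LHS]addr0 -[0 in LHS](scale0r (delta_mx 0 i)) EP addr0.
have -> : form_deriv (p + (i < j)%N) (q + ~~ (i < j)%N) lambda = P^`().[x].
  rewrite /form_deriv /P /x; case: ifP => _ /=; rewrite ?addn0 ?addn1 raddf_sum horner_sum;
    apply: eq_bigr => k _ /=; rewrite derivZ derivXn hornerZ hornerMn hornerXn;
    by rewrite ffactnSr natrM subnS -mulr_natl; ring.
rewrite /right_partial; apply: cvg_lim => //.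
apply: cvg_trans (@right_derivative_poly P x).
apply: near_eq_cvg; near=> h.
have h0 : 0 <= h by apply: ltW; near: h; exact: nbhs_right_gt.
by rewrite HG; [rewrite HG// EP EP0|exact: l0h].
Unshelve. all: by end_near. Qed.

Lemma iterated_right_partial G (r : seq 'I_m) :
  (forall lambda, orthant lambda -> G lambda = form_deriv 0 0 lambda) ->
  forall lambda, orthant lambda -> foldr (@right_partial R m) G r lambda =
    form_deriv (count (fun i : 'I_m => (i < j)%N) r)
               (count (fun i : 'I_m => ~~ (i < j)%N) r) lambda.
Proof.
move=> HG; elim: r => [//|i r IH] lambda l0 /=.
by rewrite (right_partial_form i IH)// addnC [in X in form_deriv _ X]addnC.
Qed.

End iterated_derivatives.

(** After j derivatives in S and n+1-j in T the only term of the form that survives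
at 0 is that of index j. *)
Lemma mixed_volume_coef n j (K : set 'rV[R]_n.+1) (c : nat -> R) :
  (j <= n.+1)%N -> body K ->
  (forall s t, 0 <= s -> 0 <= t ->
    volR (msum (dilate s K) (dilate t (unit_ball R n.+1))) =
      \sum_(k < n.+2) c k * s ^+ k * t ^+ (n.+1 - k)) ->
  c j = 'C(n.+1, j)%:R *
    mixed_volume (fun i : 'I_n.+1 => if (i < j)%N then K else unit_ball R n.+1).
Proof.
move=> jn bK Hc.
have cnt : count (fun i : 'I_n.+1 => (i < j)%N) (enum 'I_n.+1) = j.
  have -> : count (fun i : 'I_n.+1 => (i < j)%N) (enum 'I_n.+1) =
      count (fun k => (k < j)%N) (map val (enum 'I_n.+1)) by rewrite count_map.
  have := filter_iota_ltn 0 jn; rewrite add0n => fE.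
  by rewrite val_enum_ord -size_filter fE size_iota.
have cnt' : count (fun i : 'I_n.+1 => ~~ (i < j)%N) (enum 'I_n.+1) = (n.+1 - j)%N.
  have := count_predC (fun i : 'I_n.+1 => (i < j)%N) (enum 'I_n.+1).
  by rewrite cnt size_enum_ord => E; apply: (@addnI j); rewrite subnKC.
rewrite /mixed_volume.
rewrite (@iterated_right_partial n.+1 j n.+1 c).
- rewrite cnt cnt' /form_deriv (bigD1 (Ordinal (jn : (j < n.+2)%N)))//= big1 => [|k kj].
    rewrite !subnn !expr0 !ffactnn !mulr1 addr0 -(bin_fact jn) !natrM.
    field; by rewrite !pnatr_eq0 -!lt0n !fact_gt0 bin_gt0 jn.
  have {}kj : (k != j :> nat) by [].
  case: (ltngtP k j) kj => // kj _; first by rewrite ffact_small// mul0r mulr0 mul0r.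
  have kn : (k <= n.+1)%N by rewrite -ltnS.
  have lt : (n.+1 - k < n.+1 - j)%N by rewrite ltn_sub2l// (leq_trans kj).
  by rewrite [X in _ * (X%:R * _)](ffact_small lt) mul0r mulr0.
- move=> lambda l0; rewrite minkowski_comb_two//; last exact: body_unit_ball.
  rewrite -/(volR _) Hc; [|by apply: sumr_ge0 => i _; exact: l0..].
  apply: eq_bigr => k _; by rewrite !ffactn0 !subn0 !mul1r.
- by move=> i; rewrite mxE.
Qed.

End mixed_volumes.

(** * Second-order consequence of log-concavity *)
Section second_order.
Context (R : realType).

Lemma expr_expansion2 (a : R) n : exists E : {poly R}, forall s,
  (1 - a * s) ^+ n =
    1 - n%:R * a * s + (n%:R * (n%:R - 1) / 2) * a ^+ 2 * s ^+ 2 + s ^+ 3 * E.[s].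
Proof.
elim: n => [|n [E HE]].
  by exists 0 => s; rewrite horner0 expr0; ring.
exists ((1 - a *: 'X) * E - (n%:R * (n%:R - 1) / 2 * a ^+ 3)%:P) => s.
rewrite exprSr HE hornerD hornerN hornerM hornerD hornerN hornerZ hornerX !hornerC -natr1.
by field.
Qed.

(** Writing phi = v + s^2 Q(s), the inequality v phi(2s) <= phi(s)^2 divided by s^2
becomes 4 v Q(2s) <= 2 v Q(s) + s^2 Q(s)^2, and s tends to 0. *)
Lemma log_concave_second_order (v k d : R) (E : {poly R}) (phi : R -> R) :
  0 < v -> 0 < d -> (forall s, phi s = v + k * s ^+ 2 + s ^+ 3 * E.[s]) ->
  (forall s, 0 < s -> s <= d -> v * phi (2 * s) <= phi s ^+ 2) -> k <= 0.
Proof.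
move=> v0 d0 Hphi H.
pose Q := k%:P + 'X * E.
pose Q2 := k%:P + (2 *: 'X) * (E \Po (2 *: 'X)).
have : (((4 * v) *: Q2) : {poly R}).[0] <= ((2 * v) *: Q + 'X^2 * Q ^+ 2).[0].
  apply: (horner_le_at0 d0) => s s0 sd; have := H s s0 sd.
  rewrite !Hphi hornerD hornerM !hornerZ hornerXn horner_exp /Q2 /Q.
  rewrite !(hornerD, hornerM, hornerC, hornerX, hornerZ, horner_comp).
  set A := E.[2 * s]; set B := E.[s] => h.
  have s2 : 0 < s ^+ 2 by rewrite exprn_gt0.
  rewrite -(ler_pM2l s2); lra.
rewrite !(hornerD, hornerM, hornerC, hornerX, hornerZ, hornerXn, horner_comp, horner_exp).
move=> h; have : (2 * v) * k <= 0 by lra.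
by rewrite pmulr_rle0// mulr_gt0.
Qed.

End second_order.

(** The choice a = V(K, D[n-1]) / vol(D) below cancels the linear term of
vol(s K + (1 - a s) D); the bound d keeps 1 - 2 a s nonnegative. *)
Theorem corollary7p1 (R : realType) (n : nat) (hn : (2 <= n)%N)
    (K : set 'rV[R]_n) (hK : K_plus_infty K) :
  mixed_volume (fun i : 'I_n => if (i < 1)%N then K else unit_ball R n) ^+ 2 >=
  mixed_volume (fun i : 'I_n => if (i < 2)%N then K else unit_ball R n) *
    fine (vol (unit_ball R n)).
Proof.
case: n hn K hK => [//|[//|n]] _ K [/convex_body_body bK _ _ _].
rewrite -/(volR _).
(* if the ball had volume 0 the right-hand side would vanish *)
have [|vB] := leP (volR (unit_ball R n.+2)) 0.
  move=> h; have -> : volR (unit_ball R n.+2) = 0.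
    by apply/eqP; rewrite eq_le h volR_ge0.
  by rewrite mulr0 sqr_ge0.
have [c Hc] := steiner vB bK.
have E1 := @mixed_volume_coef R n.+1 1 K c isT bK Hc.
have E2 := @mixed_volume_coef R n.+1 2 K c isT bK Hc.
set W1 := mixed_volume _ in E1 *; set W2 := mixed_volume _ in E2 *.
clearbody W1 W2.
set V := volR _ in vB *.
have bB := body_unit_ball R n.+2; have [_ cB vxB] := bB; have [K0 cK vK] := bK.
have c0 : c 0%N = V.
  have := Hc 0 1 (lexx 0) ler01.
  rewrite dilate0// msumC msum0 dilate1 big_ord_recl /= big1 => [|i _]; last first.
    by rewrite /bump expr0n mulr0 mul0r.
  by rewrite expr0 expr1n !mulr1 addr0.
rewrite bin1 in E1.
have Hbin : 'C(n.+2, 2)%:R = n.+2%:R * (n.+2%:R - 1) / 2 :> R.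
  have := mul_bin_diag n.+2 1; rewrite /= bin1 => /(congr1 (fun k => k%:R : R)).
  rewrite !natrM => H; have -> : n.+2%:R - 1 = n.+1%:R :> R by rewrite -[n.+2%:R]natr1 addrK.
  by rewrite H; field.
rewrite Hbin in E2.
pose a := W1 / V.
pose d := (2 * `|a| + 1)^-1.
have d0 : 0 < d by rewrite invr_gt0 ltr_wpDl// mulr_ge0.
have as_le s : 0 < s -> s <= d -> 0 <= 1 - a * (2 * s) /\ 0 <= 1 - a * s.
  move=> s0 sd; have : `|a * (2 * s)| <= 1.
    rewrite normrM (gtr0_norm (_ : 0 < 2 * s)) ?mulr_gt0//.
    have : `|a| * (2 * s) <= `|a| * (2 * d) by rewrite ler_wpM2l// ler_pM2l.
    have : (2 * `|a| + 1) * d = 1 by rewrite mulfV// gt_eqF// -invr_gt0.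
    lra.
  by rewrite ler_norml => /andP[h1 h2]; split; lra.
have [X HX] : exists E : {poly R}, forall s,
   \sum_(k < n.+3) c k * s ^+ k * (1 - a * s) ^+ (n.+2 - k) =
   V + (n.+2%:R * (n.+2%:R - 1) / 2 * (W2 - W1 ^+ 2 / V)) * s ^+ 2 + s ^+ 3 * E.[s].
  have [F0 H0] := expr_expansion2 a n.+2.
  have [F1 H1] := expr_expansion2 a n.+1.
  have [F2 H2] := expr_expansion2 a n.
  pose M : R := n.+2%:R.
  pose T : {poly R} := \sum_(i < n) c i.+3 *: ('X^i * (1 - a *: 'X) ^+ (n - i.+1)).
  have HT s : \sum_(i < n) c (1 + (1 + (1 + i)))%N * s ^+ (1 + (1 + (1 + i))) *
       (1 - a * s) ^+ (n.+2 - (1 + (1 + (1 + i)))) = s ^+ 3 * T.[s].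
    rewrite /T horner_sum mulr_sumr; apply: eq_bigr => i _; rewrite !add1n !subSS.
    rewrite hornerZ hornerM hornerXn horner_exp hornerD hornerN hornerZ hornerX hornerC.
    by rewrite -[i.+3]addn3 exprD; ring.
  have M1 : n.+1%:R = M - 1 by rewrite /M -[n.+2%:R]natr1 addrK.
  have M2 : n%:R = M - 2 by rewrite /M -[n.+2%:R]natr1 -natr1; ring.
  exists (V *: F0 + (M * W1) *: (((M - 1) * (M - 1 - 1) / 2 * a ^+ 2)%:P + 'X * F1)
     + (M * (M - 1) / 2 * W2) *: (- ((M - 2) * a)%:P +
         ((M - 2) * (M - 2 - 1) / 2 * a ^+ 2) *: 'X + 'X^2 * F2)
     + T) => s.
  rewrite !big_ord_recl /= /bump /= HT.
  rewrite !(hornerD, hornerM, hornerC, hornerX, hornerZ, hornerXn, hornerN).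
  rewrite !subSS !subn0 H0 H1 H2 M1 M2 c0 E1 E2 -/M.
  have Va : V * a = W1 by rewrite /a mulrC divfK// gt_eqF.
  have Va2 : W1 ^+ 2 / V = W1 * a by rewrite /a expr2 mulrA.
  rewrite Va2 -Va.
  move: (V) (a) (M) => v b m.
  rewrite /= !addn0 !expr0 !expr1.
  by field.
have K2 : n.+2%:R * (n.+2%:R - 1) / 2 * (W2 - W1 ^+ 2 / V) <= 0.
  apply: (log_concave_second_order vB d0 HX) => s s0 sd.
  have [h1 h2] := as_le s s0 sd; have s0' := ltW s0.
  have s2 : 0 <= 2 * s by rewrite mulr_ge0.
  rewrite -(Hc (2 * s) (1 - a * (2 * s)) s2 h1) -(Hc s (1 - a * s) s0' h2).
  apply: brunn_minkowski_midpoint => //.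
  - by apply: compact_msum; exact: compact_dilate.
  - by apply: compact_msum; exact: compact_dilate.
  move=> b _ Bb [_ [x Kx <-] [_ [y By <-] <-]].
  exists (s *: x); first by exists x.
  exists (2^-1 *: (b + (1 - a * (2 * s)) *: y)); last first.
    by apply/rowP => i; rewrite !mxE; field.
  have -> : 1 - a * s = 2^-1 * (1 + (1 - a * (2 * s))) by field.
  rewrite -dilateM dilateD//; exists (b + (1 - a * (2 * s)) *: y) => //.
  exists b; first by exists b; rewrite ?scale1r.
  by exists ((1 - a * (2 * s)) *: y) => //; exists y.
have N0 : 0 < n.+2%:R * (n.+2%:R - 1) / 2 :> R.
  rewrite divr_gt0// mulr_gt0 ?ltr0n// subr_gt0 ltr1n//.
by move: K2; rewrite pmulr_rle0// subr_le0 ler_pdivlMr.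
Qed.
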